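(* Let $n\geq 3$ and $\ell_1,\ldots,\ell_n\in\mathbb{R}_{>0}$. There exists a hyperbolic cyclic polygon with $n$ sides of lengths $\ell_1,\ldots,\ell_n$ (in this cyclic order) if and only if for all $k\in\{1,\ldots,n\}$ $$\ell_k<\sum_{\substack{i=1\\ i\neq k}}^{n}\ell_i,$$ and in this case the hyperbolic cyclic polygon is unique (up to isometries of the hyperbolic plane).
   Context: The hyperbolic plane $\mathbb{H}^2$ has constant curvature $-1$. A convex hyperbolic polygon with $n$ vertices $p_1,\ldots,p_n$ in cyclic order, whose sides are the geodesic segments $p_kp_{k+1}$ (indices modulo $n$), is called cyclic if its vertices lie on a curve of constant non-zero (geodesic) curvature. Such a curve is either a hyperbolic circle (curvature greater than $1$), a horocycle (curvature equal to $1$), or a hypercycle, i.e., a curve at constant distance $R>0$ from a geodesic, on one side of it (curvature strictly between $0$ and $1$). The $n$ vertices are distinct and occur along the curve in the given order (cyclic order on a circle; in the case of a horocycle or hypercycle, monotone order along the curve up to a cyclic shift of the labels). The $k$-th side has length $\ell_k$, the hyperbolic distance between $p_k$ and $p_{k+1}$. Two polygons are identified if an isometry of $\mathbb{H}^2$ maps one to the other, respecting the labelling of the sides. *)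

(* Defs.v *)
From mathcomp Require Import all_boot all_order all_algebra.
From mathcomp Require Import all_classical all_reals all_analysis.
Set Implicit Arguments.
Unset Strict Implicit.
Unset Printing Implicit Defensive.
Import Order.TTheory GRing.Theory Num.Theory.
Import numFieldNormedType.Exports.
Local Open Scope ring_scope.

(* Hyperboloid model of the hyperbolic plane:
   the upper sheet of <v, v> = -1 in Minkowski space R^{2,1}, whose time
   coordinate is coordinate 0. *)

Definition mink (R : realType) (u v : 'rV[R]_3) : R :=
  - (u 0 0 * v 0 0) + u 0 1 * v 0 1 + u 0 2%:R * v 0 2%:R.

Record H2 (R : realType) := MkH2 {
  H2val :> 'rV[R]_3;
  H2P : (mink H2val H2val == -1) && (0 < H2val 0 0)
}.

(* On [1, +oo[; junk below 1. *)
Definition arcosh (R : realType) (x : R) : R := ln (x + Num.sqrt (x ^+ 2 - 1)).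

Definition hdist (R : realType) (x y : H2 R) : R := arcosh (- mink x y).

Definition H2_isometry (R : realType) (f : H2 R -> H2 R) : Prop :=
  bijective f /\ forall x y, hdist (f x) (f y) = hdist x y.

Definition det3 (R : realType) (u v w : 'rV[R]_3) : R :=
  \det (\matrix_(i < 3) tnth [tuple u; v; w] i).

(* The geodesic through x <> y is the zero locus in H2 of det3 x y, and its two
   sides are the two signs of det3 x y. The condition says that every side
   p_k p_(k+1) is an edge of the convex hull with no further vertex on its line;
   as n distinct such edges form a closed walk, the polygon is the boundary of
   that hull. ordS is the successor modulo n. *)
Definition convex_polygon (R : realType) (n : nat) (p : 'I_n -> H2 R) : Prop :=
  injective p /\
  forall k : 'I_n,
    (forall j, j != k -> j != ordS k -> 0 < det3 (p k) (p (ordS k)) (p j)) \/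
    (forall j, j != k -> j != ordS k -> det3 (p k) (p (ordS k)) (p j) < 0).

(* A complete twice differentiable curve, parametrized by arc length, whose
   signed geodesic curvature is constantly kappa. If T = c' and (T, N) is the
   positively oriented orthonormal frame of the tangent plane at c, i.e.
   det3 c T N = 1, the covariant derivative of T is the tangential part c'' - c
   of c'', so the curvature is <c'' - c, N> = det3 c c' c''. *)
Definition constant_curvature_curve (R : realType) (c : R -> H2 R) (kappa : R)
    : Prop :=
  let g : R -> 'rV[R]_3 := fun t => c t in
  let g' := derive1 g in
  [/\ forall t, derivable g t 1,
      forall t, derivable g' t 1,
      forall t, mink (g' t) (g' t) = 1
    & forall t, det3 (g t) (g' t) (derive1 g' t) = kappa].

(* The points p_s, p_(s+1), ..., p_(s+n-1) (indices modulo n) are met in this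
   order, for some cyclic shift s, along a simple arc of the curve. On a circle,
   whose parametrization is periodic, injectivity on [a, b] keeps the arc
   shorter than a full turn, which makes this the cyclic order. *)
Definition occur_in_order (R : realType) (n : nat) (p : 'I_n -> H2 R)
    (c : R -> H2 R) : Prop :=
  exists (a b : R) (t : 'I_n -> R) (s : nat),
    [/\ {in `[a, b] &, injective c},
        forall i, t i \in `[a, b],
        forall i j : 'I_n, (i < j)%N -> t i < t j
      & forall i, p (iter s (@ordS n) i) = c (t i)].

Definition cyclic_polygon (R : realType) (n : nat) (p : 'I_n -> H2 R) : Prop :=
  convex_polygon p /\
  exists (c : R -> H2 R) (kappa : R),
    [/\ kappa != 0, constant_curvature_curve c kappa & occur_in_order p c].

Definition has_side_lengths (R : realType) (n : nat) (p : 'I_n -> H2 R)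
    (l : 'I_n -> R) : Prop :=
  forall k, hdist (p k) (p (ordS k)) = l k.

Definition congruent (R : realType) (n : nat) (p q : 'I_n -> H2 R) : Prop :=
  exists f : H2 R -> H2 R, H2_isometry f /\ forall k, f (p k) = q k.

(* Main.v *)
Require Import Defs.
From mathcomp Require Import all_boot all_order all_algebra.
From mathcomp Require Import all_classical all_reals all_analysis.
From mathcomp Require Import ring lra zify.
Set Implicit Arguments.
Unset Strict Implicit.
Unset Printing Implicit Defensive.
Import Order.TTheory GRing.Theory Num.Theory.
Import numFieldNormedType.Exports.
Local Open Scope ring_scope.

(** Circles, horocycles and hypercycles are treated at once through the number
    [x = 1 - kappa ^+ 2 < 1] and the solutions [sn x], [cs x] of sn' = cs,
    cs' = x sn with sn 0 = 0, cs 0 = 1: the trigonometric functions if x < 0, the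
    functions t and 1 if x = 0, the hyperbolic functions if x > 0. Solving the
    Frenet equations ([constant_curvature_curve_formula]) shows that two points
    at arc length distance 2 t satisfy - <p, q> = 1 + 2 (sn x t)^2. Hence a
    side of length l spans a half arc t with sn x t = sinh (l / 2) = sn 1 (l / 2).

    Cut a cyclic polygon at a longest side m ([arcs_at_longest]). The other sides
    have half arcs z_i, none beyond a quarter period, with
    sn x z_i = sinh (l_i / 2), and their sum Z, below a half period, satisfies
    sn x Z = sinh (l_m / 2). Conversely such x < 1 and z_i give a polygon on an
    explicit curve ([model_polygon_cyclic], [model_polygon_sides]).

    The key is [arm_lemma]: when the chords sn x z_i are kept and x increases,
    the closing chord sn x Z strictly increases. Two consequences follow.
    - Uniqueness: the sides determine x, then the z_i, then the Gram matrix of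
      the vertices ([cyclic_polygon_gram]), and vertices with the same Gram
      matrix differ by a Lorentz transformation ([congruent_of_gram]).
    - Necessity: at x = 1, where the curve is a geodesic, the half arcs are
      l_i / 2; as the polygon has x < 1, sinh (l_m / 2) is smaller than
      sinh (sum of the l_i / 2) ([longest_lt_sum]).
    Existence is a matter of continuity: [closing_parameter] finds x by the
    intermediate value theorem, on a circle, a horocycle or a hypercycle
    according to the comparison of sinh (l_m / 2) with the sum of the other
    sinh (l_i / 2). *)

(** * Sine and cosine of a curve of constant curvature *)

Section GeneralizedTrigonometry.
Context {R : realType}.
Implicit Types x t a b u v z : R.

(** The solution of [f'' = x f], [f 0 = 0], [f' 0 = 1]. With [x = 1 - kappa ^+ 2] the sign of
    [x] separates circles, horocycles and hypercycles, so that one function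
    serves the three kinds of curves. *)
Definition sn x t : R :=
  let w := Num.sqrt `|x| in
  if x < 0 then sin (w * t) / w
  else if x == 0 then t else (expR (w * t) - expR (- (w * t))) / (2 * w).

Definition cs x t : R :=
  let w := Num.sqrt `|x| in
  if x < 0 then cos (w * t)
  else if x == 0 then 1 else (expR (w * t) + expR (- (w * t))) / 2.

Lemma is_derive_scaled (f : R -> R) (w t d : R) :
  is_derive (w * t) (1 : R) f d -> is_derive t (1 : R) (fun s => f (w * s)) (w * d).
Proof.
move=> fd.
have gd : is_derive t (1 : R) (fun s : R => w * s) w.
  by apply: is_derive_eq; rewrite /GRing.scale /= mulr1 ?mulr0 ?addr0.
have -> : (fun s => f (w * s)) = f \o (fun s : R => w * s) by [].
by apply: is_derive_eq; rewrite /GRing.scale /= mulrC.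
Qed.

Lemma sqrt_norm_gt0 x : x != 0 -> 0 < Num.sqrt `|x|.
Proof. by move=> x0; rewrite sqrtr_gt0 normr_gt0. Qed.

Lemma sqr_sqrt_norm x : Num.sqrt `|x| ^+ 2 = `|x|.
Proof. by rewrite sqr_sqrtr. Qed.

Lemma is_derive_sn x t : is_derive t (1 : R) (sn x) (cs x t).
Proof.
rewrite /sn /cs; have [x0|x0|x0] := ltgtP x 0.
- have w0 := sqrt_norm_gt0 (ltr0_neq0 x0).
  set w := Num.sqrt _ in w0 *.
  have h := is_derive_scaled (is_derive_sin (w * t)).
  have -> : (fun t => sin (w * t) / w) = w^-1 \*: (fun t => sin (w * t)).
    by apply/funext => s; rewrite /GRing.scale /= mulrC.
  by apply: is_derive_eq; rewrite /GRing.scale /=; field; rewrite gt_eqF.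
- have w0 := sqrt_norm_gt0 (lt0r_neq0 x0).
  set w := Num.sqrt _ in w0 *.
  have h := is_derive_scaled (is_derive_expR (w * t)).
  have h' := is_derive_scaled (is_derive_expR (- w * t)).
  have -> : (fun t => (expR (w * t) - expR (- (w * t))) / (2 * w)) =
     (2 * w)^-1 \*: ((fun t => expR (w * t)) - (fun t => expR (- w * t))).
    by apply/funext => s; rewrite !fctE /GRing.scale /= [LHS]mulrC mulNr.
  apply: is_derive_eq; rewrite /GRing.scale /= !mulNr.
  by field; rewrite gt_eqF.
- exact: is_derive_id.
Qed.

Lemma is_derive_cs x t : is_derive t (1 : R) (cs x) (x * sn x t).
Proof.
rewrite /sn /cs; have [x0|x0|x0] := ltgtP x 0.
- have w0 := sqrt_norm_gt0 (ltr0_neq0 x0).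
  have w2 : x = - Num.sqrt `|x| ^+ 2 by rewrite sqr_sqrt_norm ltr0_norm ?opprK.
  set w := Num.sqrt _ in w0 w2 *.
  have h := is_derive_scaled (is_derive_cos (w * t)).
  apply: is_derive_eq; rewrite w2.
  by field; rewrite gt_eqF.
- have w0 := sqrt_norm_gt0 (lt0r_neq0 x0).
  have w2 : x = Num.sqrt `|x| ^+ 2 by rewrite sqr_sqrt_norm gtr0_norm.
  set w := Num.sqrt _ in w0 w2 *.
  have h := is_derive_scaled (is_derive_expR (w * t)).
  have h' := is_derive_scaled (is_derive_expR (- w * t)).
  have -> : (fun t => (expR (w * t) + expR (- (w * t))) / 2) =
     2^-1 \*: ((fun t => expR (w * t)) + (fun t => expR (- w * t))).
    by apply/funext => s; rewrite !fctE /GRing.scale /= [LHS]mulrC mulNr.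
  apply: is_derive_eq; rewrite /GRing.scale /= {1}w2 !mulNr.
  by field; rewrite gt_eqF.
- by rewrite x0 mul0r; exact: is_derive_cst.
Qed.
#[local] Existing Instance is_derive_sn.
#[local] Existing Instance is_derive_cs.

Lemma sn0 x : sn x 0 = 0.
Proof.
by rewrite /sn !mulr0 oppr0 subrr !(sin0, mul0r); case: ifP => // _; case: ifP.
Qed.

Lemma cs0 x : cs x 0 = 1.
Proof.
rewrite /cs !mulr0 oppr0 expR0 cos0; case: ifP => // _; case: ifP => // _.
by rewrite divff// pnatr_eq0.
Qed.

(** The derivative of [cs ^ 2 - x sn ^ 2] vanishes. The derivatives of [sn] and
    [cs] and their values at 0 yield the algebraic identities in this way,
    without distinguishing the sign of [x]. *)
Lemma cs2 x t : cs x t ^+ 2 = 1 + x * sn x t ^+ 2.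
Proof.
apply/eqP; rewrite -subr_eq; apply/eqP.
have -> : cs x t ^+ 2 - x * sn x t ^+ 2 = cs x 0 ^+ 2 - x * sn x 0 ^+ 2.
  apply: (@is_derive_0_is_cst R (fun t => cs x t ^+ 2 - x * sn x t ^+ 2)) => s.
  have -> : (fun t => cs x t ^+ 2 - x * sn x t ^+ 2) =
     (cs x ^+ 2 - x \*: (sn x ^+ 2)) by apply/funext => u /=.
  by apply: is_derive_eq; rewrite /GRing.scale /=; ring.
by rewrite sn0 cs0; ring.
Qed.

Lemma is_derive_shift_arg (f : R -> R) (a t d : R) :
  is_derive (t + a) (1 : R) f d -> is_derive t (1 : R) (fun s => f (s + a)) d.
Proof.
move=> fd.
have gd : is_derive t (1 : R) (fun s : R => s + a) 1.
  by apply: is_derive_eq; rewrite ?addr0.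
have -> : (fun s => f (s + a)) = f \o (fun s : R => s + a) by [].
by apply: is_derive_eq; rewrite /GRing.scale /= ?mulr1 ?mul1r.
Qed.

Lemma snD_csD x a b :
  sn x (a + b) = sn x a * cs x b + cs x a * sn x b /\
  cs x (a + b) = cs x a * cs x b + x * (sn x a * sn x b).
Proof.
(* For fixed u the left-hand sides do not depend on v; solving the two
   equations for sn (v + u) and cs (v + u) gives the addition formulas. *)
have P u v : cs x v * sn x (v + u) - sn x v * cs x (v + u) = sn x u.
  have -> : cs x v * sn x (v + u) - sn x v * cs x (v + u) =
            cs x 0 * sn x (0 + u) - sn x 0 * cs x (0 + u).
    apply: (@is_derive_0_is_cst R
      (fun v => cs x v * sn x (v + u) - sn x v * cs x (v + u))) => s.
    have h1 := is_derive_shift_arg (is_derive_sn x (s + u)).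
    have h2 := is_derive_shift_arg (is_derive_cs x (s + u)).
    have -> : (fun v => cs x v * sn x (v + u) - sn x v * cs x (v + u)) =
       cs x * (fun v => sn x (v + u)) - sn x * (fun v => cs x (v + u)).
      by apply/funext.
    by apply: is_derive_eq; rewrite /GRing.scale /=; ring.
  by rewrite sn0 cs0 add0r mul1r mul0r subr0.
have Q u v : cs x v * cs x (v + u) - x * (sn x v * sn x (v + u)) = cs x u.
  have -> : cs x v * cs x (v + u) - x * (sn x v * sn x (v + u)) =
            cs x 0 * cs x (0 + u) - x * (sn x 0 * sn x (0 + u)).
    apply: (@is_derive_0_is_cst R
      (fun v => cs x v * cs x (v + u) - x * (sn x v * sn x (v + u)))) => s.
    have h1 := is_derive_shift_arg (is_derive_sn x (s + u)).
    have h2 := is_derive_shift_arg (is_derive_cs x (s + u)).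
    have -> : (fun v => cs x v * cs x (v + u) - x * (sn x v * sn x (v + u))) =
       cs x * (fun v => cs x (v + u)) - x \*: (sn x * (fun v => sn x (v + u))).
      by apply/funext.
    by apply: is_derive_eq; rewrite /GRing.scale /=; ring.
  by rewrite sn0 cs0 add0r mul1r mul0r mulr0 subr0.
have := P b a; have := Q b a; have := cs2 x a.
set A := sn x (a + b); set B := cs x (a + b).
move=> e <- <-; split.
  have -> : sn x a * (cs x a * B - x * (sn x a * A)) +
     cs x a * (cs x a * A - sn x a * B) = A * (cs x a ^+ 2 - x * sn x a ^+ 2).
    by ring.
  by rewrite e; ring.
have -> : cs x a * (cs x a * B - x * (sn x a * A)) +
  x * (sn x a * (cs x a * A - sn x a * B)) = B * (cs x a ^+ 2 - x * sn x a ^+ 2).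
  by ring.
by rewrite e; ring.
Qed.

Lemma snD x a b : sn x (a + b) = sn x a * cs x b + cs x a * sn x b.
Proof. exact: (snD_csD x a b).1. Qed.

Lemma csD x a b : cs x (a + b) = cs x a * cs x b + x * (sn x a * sn x b).
Proof. exact: (snD_csD x a b).2. Qed.

Lemma snN x t : sn x (- t) = - sn x t.
Proof.
have := snD x t (- t); have := csD x t (- t); rewrite subrr sn0 cs0 => e1 e2.
have e := cs2 x t.
have : (cs x t ^+ 2 - x * sn x t ^+ 2) * (sn x (- t) + sn x t) = 0.
  have -> : (cs x t ^+ 2 - x * sn x t ^+ 2) * (sn x (- t) + sn x t) =
    cs x t * (sn x t * cs x (- t) + cs x t * sn x (- t)) - sn x t *
    (cs x t * cs x (- t) + x * (sn x t * sn x (- t)))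
     + sn x t * (cs x t ^+ 2 - x * sn x t ^+ 2) by ring.
  by rewrite -e1 -e2 e; ring.
by rewrite e addrK mul1r => /eqP; rewrite addr_eq0 => /eqP.
Qed.

Lemma csN x t : cs x (- t) = cs x t.
Proof.
have := csD x t (- t); have := snD x t (- t); rewrite subrr sn0 cs0 snN => e1 e2.
have e := cs2 x t.
have : (cs x t ^+ 2 - x * sn x t ^+ 2) * (cs x (- t) - cs x t) = 0.
  have -> : (cs x t ^+ 2 - x * sn x t ^+ 2) * (cs x (- t) - cs x t) =
    cs x t * (cs x t * cs x (- t) + x * (sn x t * - sn x t)) - x * sn x t *
    (sn x t * cs x (- t) + cs x t * - sn x t)
     - cs x t * (cs x t ^+ 2 - x * sn x t ^+ 2) by ring.
  by rewrite -e1 -e2 e; ring.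
by rewrite e addrK mul1r => /eqP; rewrite subr_eq0 => /eqP.
Qed.

Lemma snB x a b : sn x (a - b) = sn x a * cs x b - cs x a * sn x b.
Proof. by rewrite snD snN csN mulrN. Qed.

Lemma sn_sub x a b :
  sn x b - sn x a = 2 * (cs x ((a + b) / 2) * sn x ((b - a) / 2)).
Proof.
have -> : sn x b = sn x ((a + b) / 2 + (b - a) / 2) by congr sn; field.
have -> : sn x a = sn x ((a + b) / 2 - (b - a) / 2) by congr sn; field.
by rewrite snD snB; ring.
Qed.

Lemma sn_neg x t : x < 0 -> sn x t = sin (Num.sqrt `|x| * t) / Num.sqrt `|x|.
Proof. by rewrite /sn => ->. Qed.

Lemma cs_neg x t : x < 0 -> cs x t = cos (Num.sqrt `|x| * t).
Proof. by rewrite /cs => ->. Qed.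

(** The interval on which [sn x] is positive: [t] lies before the half period
    [pi / sqrt (- x)] if [x < 0], and there is no upper bound otherwise. *)
Definition short x t := 0 < t /\ (x < 0 -> Num.sqrt `|x| * t < pi).

Lemma short_le x a b : 0 < a -> a <= b -> short x b -> short x a.
Proof.
move=> a0 ab [b0 bs]; split=> // x0; apply: le_lt_trans (bs x0).
by rewrite ler_wpM2l// sqrtr_ge0.
Qed.

Lemma cs_gt0 x t : 0 <= x -> 0 < cs x t.
Proof.
rewrite le_eqVlt => /orP[/eqP <-|x0]; first by rewrite /cs ltxx eqxx.
rewrite /cs (lt_gtF x0) (gt_eqF x0).
by rewrite divr_gt0// addr_gt0// expR_gt0.
Qed.

Lemma sn_gt0 x t : short x t -> 0 < sn x t.
Proof.
rewrite /sn => -[t0 xt]; case: (ltgtP x 0) xt => [x0|x0|_ _ //] xt.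
  have w0 := sqrt_norm_gt0 (ltr0_neq0 x0).
  by rewrite divr_gt0// sin_gt0_pi// (xt isT) mulr_gt0.
have w0 := sqrt_norm_gt0 (lt0r_neq0 x0).
by rewrite divr_gt0 ?mulr_gt0 ?ltr0n// subr_gt0 ltr_expR gtrN// mulr_gt0.
Qed.

Lemma cs_lt x a b : x < 0 -> 0 <= a -> a < b -> short x b -> cs x b < cs x a.
Proof.
move=> x0 a0 ab [b0 /(_ x0) bs]; rewrite !cs_neg//.
have w0 := sqrt_norm_gt0 (ltr0_neq0 x0).
by rewrite ltr_cos ?ltr_pM2l// in_itv /= ?(ltW bs) ?mulr_ge0 ?(ltW w0) ?(ltW b0)//=
  (le_trans _ (ltW bs))// ler_pM2l// ltW.
Qed.

Lemma cs_mid_gt0 x a b :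
  0 <= a -> a < b -> short x b -> 0 <= cs x b -> 0 < cs x a.
Proof.
move=> a0 ab bs cb; have [x0|x0] := ltP x 0; last exact: cs_gt0.
by rewrite (le_lt_trans cb)// cs_lt.
Qed.

Lemma cs_ge0_le x a b :
  0 <= a -> a <= b -> short x b -> 0 <= cs x b -> 0 <= cs x a.
Proof.
move=> a0; rewrite le_eqVlt => /orP[/eqP-> //|ab bs cb].
exact/ltW/(cs_mid_gt0 a0 ab).
Qed.

(** Up to a quarter period, expressed by [0 <= cs x b], [sn x] increases: its
    increment is a product of [cs] at the midpoint and [sn] at the half
    difference. *)
Lemma sn_lt x a b :
  0 <= a -> a < b -> short x b -> 0 <= cs x b -> sn x a < sn x b.
Proof.
move=> a0 ab bs cb; rewrite -subr_gt0 sn_sub !mulr_gt0 ?ltr0n//.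
  by apply: (@cs_mid_gt0 _ _ b) => //; lra.
by apply: sn_gt0; apply: short_le bs; lra.
Qed.

Lemma sn_inj_quarter x a b : short x a -> short x b ->
  0 <= cs x a -> 0 <= cs x b -> sn x a = sn x b -> a = b.
Proof.
move=> sa sb ca cb e; have [ab|ba|//] := ltgtP a b.
  by have := sn_lt (ltW sa.1) ab sb cb; rewrite e ltxx.
by have := sn_lt (ltW sb.1) ba sa ca; rewrite e ltxx.
Qed.

(** Beyond the quarter period the cosine at the midpoint is negative. *)
Lemma sn_gt x a b : 0 < a -> a < b -> short x b -> cs x a < 0 -> sn x b < sn x a.
Proof.
move=> a0 ab bs ca; have [x0|x0] := ltP x 0; last first.
  by have := cs_gt0 a x0; lra.
rewrite -subr_lt0 sn_sub pmulr_rlt0 ?ltr0n// pmulr_llt0.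
  by apply: lt_trans ca; apply: cs_lt; rewrite ?(ltW a0)//; [lra|apply: short_le bs; lra].
by apply: sn_gt0; apply: short_le bs; lra.
Qed.

End GeneralizedTrigonometry.

(** * The arm lemma *)

Section ArmLemma.
Context {R : realType}.
Implicit Types x t a b : R.

Lemma sn_scale x t : x < 0 ->
  sn x t = sn (- 1) (Num.sqrt `|x| * t) / Num.sqrt `|x|.
Proof.
by move=> x0; rewrite !sn_neg ?ltrN10// normrN1 sqrtr1 mul1r divr1.
Qed.

Lemma cs_scale x t : x < 0 -> cs x t = cs (- 1) (Num.sqrt `|x| * t).
Proof. by move=> x0; rewrite !cs_neg ?ltrN10// normrN1 sqrtr1 mul1r. Qed.

Lemma short_scale x t : x < 0 -> short x t -> short (- 1) (Num.sqrt `|x| * t).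
Proof.
move=> x0 [t0 /(_ x0) h]; split; last by rewrite normrN1 sqrtr1 mul1r.
by rewrite mulr_gt0// sqrt_norm_gt0// ltr0_neq0.
Qed.

(** With Y, y the chords [sn x a], [sn x b] and r, c the corresponding cosines,
    the new chord is Y c + r y, where c = sqrt (1 + x y^2) increases with x and
    r <= sqrt (1 + x Y^2). Nothing bounds [a] by a quarter period: a negative r
    only helps. It remains to see that Y c' + y sqrt (1 + x' Y^2) increases with
    Y up to Y' = [sn x' a'], which holds because the chord of [a' + b'] is still
    on the increasing part of [sn x']. *)
Lemma arm_step x x' a b a' b' : x < x' -> 0 < a -> 0 < b -> 0 < a' -> 0 < b' ->
  short x (a + b) -> 0 <= cs x b ->
  short x' (a' + b') -> 0 <= cs x' (a' + b') ->
  sn x a <= sn x' a' -> sn x b = sn x' b' -> sn x (a + b) < sn x' (a' + b').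
Proof.
move=> xx a0 b0 a0' b0' sab cb sab' cab' aa bb.
have ca' : 0 < cs x' a' by apply: cs_mid_gt0 cab' => //; lra.
have cb' : 0 < cs x' b' by apply: cs_mid_gt0 cab' => //; lra.
have Y0 : 0 < sn x a by apply: sn_gt0; apply: short_le sab; lra.
have y0 : 0 < sn x b by apply: sn_gt0; apply: short_le sab; lra.
have e1 := cs2 x b; have e1' := cs2 x' b'.
have e2 := cs2 x a; have e2' := cs2 x' a'.
move: cab'; rewrite !snD csD -bb.
rewrite -bb in e1'.
move: (sn x a) (sn x' a') (sn x b) (cs x a) (cs x' a') (cs x b) (cs x' b')
  Y0 y0 aa cb cb' ca' e1 e1' e2 e2' => Y Y' y r r' c c'.
move=> Y0 y0 YY c0 c0' r0' e1 e1' e2 e2' q.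
have cc : c < c'.
  rewrite -(@ltr_pXn2r _ 2)// ?nnegrE ?(ltW c0')// e1 e1'.
  by rewrite ltrD2l ltr_pM2r// exprn_gt0.
have h0 : r ^+ 2 <= 1 + x' * Y ^+ 2.
  by rewrite e2 lerD2l ler_pM2r ?exprn_gt0// ltW.
(* s is the cosine, for the parameter x', of the arc with chord Y. *)
set s := Num.sqrt (1 + x' * Y ^+ 2).
have s2 : s ^+ 2 = 1 + x' * Y ^+ 2 by rewrite sqr_sqrtr// (le_trans _ h0)// sqr_ge0.
have s0 : 0 <= s by rewrite sqrtr_ge0.
have rs : r <= s.
  have [|/ltW r0] := leP r 0; first by move/le_trans; apply.
  by rewrite -(@ler_pXn2r _ 2)// s2.
suff h : Y * c' + s * y <= Y' * c' + r' * y.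
  apply: lt_le_trans h; apply: ltr_leD; first by rewrite ltr_pM2l.
  by rewrite ler_pM2r.
have [rs'|sr'] := leP s r'.
  by rewrite lerD// ler_pM2r.
have d : r' ^+ 2 - s ^+ 2 = x' * (Y' ^+ 2 - Y ^+ 2) by rewrite s2 e2'; ring.
have x0' : x' < 0.
  rewrite ltNge; apply/negP => x0'.
  have : 0 <= r' ^+ 2 - s ^+ 2.
    by rewrite d mulr_ge0// subr_ge0 lerXn2r// nnegrE ?(ltW Y0)// (le_trans (ltW Y0)).
  by rewrite subr_ge0 ler_pXn2r// ?nnegrE ?(ltW r0')// leNgt sr'.
have q' : 0 <= s * c' + x' * (Y * y).
  apply: le_trans q _; apply: lerD; first by rewrite ler_pM2r// ltW.
  by rewrite ler_nM2l// ler_pM2r.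
(* Multiplying by s + r' turns the difference r' - s into
   r' ^ 2 - s ^ 2 = x' (Y' ^ 2 - Y ^ 2), which has the factor Y' - Y. *)
rewrite -subr_ge0 -(@pmulr_lge0 _ (s + r')); last by rewrite ltr_wpDl.
have -> : (Y' * c' + r' * y - (Y * c' + s * y)) * (s + r') =
  (Y' - Y) * c' * (s + r') + y * (r' ^+ 2 - s ^+ 2) by ring.
rewrite d.
have -> : (Y' - Y) * c' * (s + r') + y * (x' * (Y' ^+ 2 - Y ^+ 2)) =
  (Y' - Y) * ((r' * c' + x' * (Y' * y)) + (s * c' + x' * (Y * y))) by ring.
by apply: mulr_ge0; [rewrite subr_ge0|apply: addr_ge0].
Qed.

(** Half arcs of consecutive chords on one curve, each at most a quarter period,
    that together stay below a half period. *)
Definition arm x N (z : nat -> R) :=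
  (forall k, (k < N)%N -> 0 < z k /\ 0 <= cs x (z k)) /\
  short x (\sum_(k < N) z k).

Lemma sum_gt0 N (z : nat -> R) : (0 < N)%N ->
  (forall k, (k < N)%N -> 0 < z k) -> 0 < \sum_(k < N) z k.
Proof.
case: N => // N _ z0; rewrite big_ord_recl ltr_pwDl ?z0// sumr_ge0// => i _.
by rewrite ltW// z0// ltnS ltn_ord.
Qed.

Lemma sum_le N j (z : nat -> R) : (j <= N)%N ->
  (forall k, (k < N)%N -> 0 < z k) -> \sum_(k < j) z k <= \sum_(k < N) z k.
Proof.
move=> jN z0; rewrite -(big_mkord predT z) -(big_mkord predT z).
rewrite [leRHS](big_cat_nat (leq0n j) jN) /= lerDl big_nat_cond sumr_ge0// => i.
by rewrite andbT => /andP[_ iN]; rewrite ltW// z0.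
Qed.

Lemma arm_short x N z j : arm x N z -> (j < N)%N -> short x (z j).
Proof.
move=> [hz sZ] jN; have z0 k : (k < N)%N -> 0 < z k by move/hz => -[].
apply: short_le sZ; first exact: z0.
apply: le_trans (sum_le jN z0); rewrite big_ord_recr /= lerDr sumr_ge0// => i _.
by rewrite ltW// z0// (ltn_trans (ltn_ord i)).
Qed.

(** Cauchy's arm lemma for inscribed chains: keep the chords and straighten the
    curve by increasing [x]; then the chord closing the chain grows. If the
    straighter chain stays within a quarter period, chords are added one at a
    time by [arm_step]. Otherwise both curves are circles; measured as angles,
    the half arcs are larger on the more curved circle, so the total angle is
    larger too, and beyond a quarter turn both its sine and the radius of that
    circle are smaller. *)
Theorem arm_lemma x x' N (z z' : nat -> R) : x < x' -> (1 < N)%N ->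
  arm x N z -> arm x' N z' ->
  (forall k, (k < N)%N -> sn x (z k) = sn x' (z' k)) ->
  sn x (\sum_(k < N) z k) < sn x' (\sum_(k < N) z' k).
Proof.
move=> xx N1 [hz sZ] [hz' sZ'] hy.
have z0 k : (k < N)%N -> 0 < z k by move/hz => -[].
have z0' k : (k < N)%N -> 0 < z' k by move/hz' => -[].
have [c0|c0] := leP 0 (cs x' (\sum_(k < N) z' k)).
  have H j : (j.+1 < N)%N ->
      sn x (\sum_(k < j.+1) z k) <= sn x' (\sum_(k < j.+1) z' k) /\
      sn x (\sum_(k < j.+2) z k) < sn x' (\sum_(k < j.+2) z' k).
    elim: j => [|j IH] jN.
      have le1 : sn x (\sum_(k < 1) z k) <= sn x' (\sum_(k < 1) z' k).
        by rewrite !big_ord1 hy// (ltn_trans _ N1).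
      split=> //; rewrite big_ord_recr [in ltRHS]big_ord_recr /=.
      have sj : \sum_(k < 2) z k <= \sum_(k < N) z k by exact: sum_le.
      have sj' : \sum_(k < 2) z' k <= \sum_(k < N) z' k by exact: sum_le.
      rewrite big_ord_recr /= in sj; rewrite big_ord_recr /= in sj'.
      have p1 : 0 < \sum_(k < 1) z k by rewrite big_ord1 z0// (ltn_trans _ N1).
      have p1' : 0 < \sum_(k < 1) z' k by rewrite big_ord1 z0'// (ltn_trans _ N1).
      apply: arm_step => //; rewrite ?z0 ?z0' ?hy ?(hz _ N1).2//.
      + by apply: short_le sZ => //; rewrite addr_gt0// z0.
      + by apply: short_le sZ' => //; rewrite addr_gt0// z0'.
      + by apply: cs_ge0_le c0 => //; rewrite addr_ge0// ltW// z0'.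
    have {IH}[_ /ltW IH] := IH (ltnW jN); split=> //.
    rewrite big_ord_recr [in ltRHS]big_ord_recr /=.
    have sj : \sum_(k < j.+3) z k <= \sum_(k < N) z k by exact: sum_le.
    have sj' : \sum_(k < j.+3) z' k <= \sum_(k < N) z' k by exact: sum_le.
    rewrite big_ord_recr /= in sj; rewrite big_ord_recr /= in sj'.
    have p1 : 0 < \sum_(k < j.+2) z k.
      by apply: sum_gt0 => // k kj; apply: z0; lia.
    have p1' : 0 < \sum_(k < j.+2) z' k.
      by apply: sum_gt0 => // k kj; apply: z0'; lia.
    apply: arm_step => //; rewrite ?z0 ?z0' ?hy ?(hz _ jN).2//.
    + by apply: short_le sZ => //; rewrite addr_gt0// z0.
    + by apply: short_le sZ' => //; rewrite addr_gt0// z0'.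
    + by apply: cs_ge0_le c0 => //; rewrite addr_ge0 ?(ltW p1')// ltW// z0'.
  case: N N1 H {hz hz' sZ sZ' hy z0 z0' c0} => [|[|N]]// _ H.
  by have [] := H N (ltnSn _).
have x0' : x' < 0.
  by rewrite ltNge; apply/negP => /(cs_gt0 (\sum_(k < N) z' k)); lra.
have x0 := lt_trans xx x0'.
have w0 := sqrt_norm_gt0 (ltr0_neq0 x0).
have w0' := sqrt_norm_gt0 (ltr0_neq0 x0').
have ww : Num.sqrt `|x'| < Num.sqrt `|x|.
  by rewrite ltr_sqrt ?normr_gt0 ?ltr0_neq0// !ltr0_norm// ltrN2.
have hs := short_scale x0 sZ.
have hs' := short_scale x0' sZ'.
have sk k : (k < N)%N -> short x (z k) by apply: arm_short.
have sk' k : (k < N)%N -> short x' (z' k) by apply: arm_short.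
rewrite (sn_scale _ x0) (sn_scale _ x0').
rewrite (cs_scale _ x0') in c0.
have lts : Num.sqrt `|x'| * \sum_(k < N) z' k < Num.sqrt `|x| * \sum_(k < N) z k.
  rewrite !mulr_sumr; case: N N1 hz hz' hy z0 z0' sk sk' {c0 hs hs' sZ sZ'}.
    by [].
  move=> N N1 hz hz' hy z0 z0' sk sk'.
  apply: ltr_sum => [|[k kN] _ /=]; first by apply/hasP; exists ord0; rewrite ?mem_index_enum.
  rewrite ltNge; apply/negP; rewrite le_eqVlt => hle.
  have y0 := sn_gt0 (sk k kN).
  have := hy k kN; rewrite (sn_scale _ x0) (sn_scale _ x0') => e.
  rewrite (sn_scale _ x0) in y0.
  move: y0 e; set A := sn _ _; set B := sn _ _ => y0 e.
  have AB : A <= B.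
    case/orP: hle => [/eqP h|h]; first by rewrite /A h.
    apply/ltW/sn_lt => //.
    - by rewrite mulr_ge0 ?(ltW w0)// ltW// z0.
    - exact: short_scale (sk' k kN).
    - by rewrite -cs_scale// (hz' _ kN).2.
  have B0 : 0 < B by apply: lt_le_trans AB; rewrite pmulr_lgt0 ?invr_gt0 in y0.
  have : A / Num.sqrt `|x| < B / Num.sqrt `|x'|.
    apply: (@le_lt_trans _ _ (B / Num.sqrt `|x|)).
      by rewrite ler_pM2r// invr_gt0.
    by rewrite ltr_pM2l// ltf_pV2.
  by rewrite e ltxx.
have := sn_gt hs'.1 lts hs c0 => h.
apply: (@lt_trans _ _ (sn (-1) (Num.sqrt `|x'| * \sum_(k < N) z' k) / Num.sqrt `|x|)).
  by rewrite ltr_pM2r// invr_gt0.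
by rewrite ltr_pM2l ?sn_gt0// ltf_pV2.
Qed.

End ArmLemma.

(** * Lorentz frames in Minkowski space *)

Section ConstantCurvature.
Context {R : realType}.
Implicit Types (x t a b k : R) (u v w : 'rV[R]_3).

Lemma ord3P (i : 'I_3) : [\/ i = 0, i = 1 | i = 2%:R].
Proof.
case: i => -[|[|[|//]]] h; [apply: Or31|apply: Or32|apply: Or33]; exact: val_inj.
Qed.

Lemma det3E u v w : det3 u v w =
  u 0 0 * (v 0 1 * w 0 2%:R - v 0 2%:R * w 0 1)
  - u 0 1 * (v 0 0 * w 0 2%:R - v 0 2%:R * w 0 0)
  + u 0 2%:R * (v 0 0 * w 0 1 - v 0 1 * w 0 0).
Proof.
rewrite /det3 (expand_det_row _ 0) !big_ord_recl big_ord0 /cofactor.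
rewrite !(expand_det_row _ 0) !big_ord_recl !big_ord0 /cofactor !det_mx11 !mxE.
have e1 : lift ord0 ord0 = 1 :> 'I_3 by apply: val_inj.
have e2 : lift ord0 (lift ord0 ord0) = 2%:R :> 'I_3 by apply: val_inj.
have f1 : lift (1 : 'I_3) ord0 = 0 by apply: val_inj.
have f2 : lift (1 : 'I_3) (lift ord0 ord0) = 2%:R by apply: val_inj.
have g1 : lift (2%:R : 'I_3) ord0 = 0 by apply: val_inj.
have g2 : lift (2%:R : 'I_3) (lift ord0 ord0) = 1 by apply: val_inj.
have h1 : lift (lift ord0 ord0 : 'I_2) 0 = ord0 :> 'I_2 by apply: val_inj.
have h0 : lift (0 : 'I_2) 0 = lift ord0 ord0 :> 'I_2 by apply: val_inj.
rewrite ?(e1, e2) ?(f1, f2, g1, g2, h0, h1) ?(e1, e2) ?(f1, f2, g1, g2).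
have -> : ord0 = 0 :> 'I_3 by apply: val_inj.
rewrite (_ : tnth _ 0 = u)// (_ : tnth _ 1 = v)// (_ : tnth _ 2%:R = w)//.
rewrite (_ : nat_of_ord (1 : 'I_3) = 1%N)// (_ : nat_of_ord (2%:R : 'I_3) = 2%N)//.
rewrite (_ : nat_of_ord (lift ord0 ord0) = 1%N)// (_ : nat_of_ord 0 = 0%N)//.
by ring.
Qed.

(** The Lorentzian cross product: [mink (lcross u v) w] is [det3 u v w]. *)
Definition lcross u v : 'rV[R]_3 := \row_j
  (if j == 0 then u 0 2%:R * v 0 1 - u 0 1 * v 0 2%:R
   else if j == 1 then u 0 2%:R * v 0 0 - u 0 0 * v 0 2%:R
   else u 0 0 * v 0 1 - u 0 1 * v 0 0).

Lemma lcrossE u v :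
  [/\ lcross u v 0 0 = u 0 2%:R * v 0 1 - u 0 1 * v 0 2%:R,
      lcross u v 0 1 = u 0 2%:R * v 0 0 - u 0 0 * v 0 2%:R
    & lcross u v 0 2%:R = u 0 0 * v 0 1 - u 0 1 * v 0 0].
Proof. by rewrite /lcross !mxE. Qed.

Definition frame u v w :=
  [/\ mink u u = -1, mink v v = 1, mink w w = 1 &
   [/\ mink u v = 0, mink u w = 0 & mink v w = 0]].

Lemma lcross_frame u v :
  mink u u = -1 -> mink v v = 1 -> mink u v = 0 -> frame u v (lcross u v).
Proof.
move=> uu vv uv; split=> //; last split=> //.
- have -> : mink (lcross u v) (lcross u v) =
    mink u v ^+ 2 - mink u u * mink v v.
    by rewrite /mink; have [-> -> ->] := lcrossE u v; ring.
  by rewrite uu vv uv; ring.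
- by rewrite /mink; have [-> -> ->] := lcrossE u v; ring.
- by rewrite /mink; have [-> -> ->] := lcrossE u v; ring.
Qed.

(** Cramer's rule for the three equations satisfied by e, whose determinant is
    [mink n n = 1] up to sign for n = [lcross u v]; the witnesses below are its
    cofactors. *)
Lemma frame_expand u v e : mink u u = -1 -> mink v v = 1 -> mink u v = 0 ->
  mink e u = 0 -> mink e v = 0 -> mink e (lcross u v) = 0 -> e = 0.
Proof.
move=> uu vv uv eu ev en; have [_ _ nn _] := lcross_frame uu vv uv.
have h i : e 0 i * mink (lcross u v) (lcross u v) = 0.
  suff [al [be [ga ->]]] : exists al be ga, e 0 i * mink (lcross u v) (lcross u v) =
      al * mink e u + be * mink e v + ga * mink e (lcross u v).
    by rewrite eu ev en !mulr0 !addr0.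
  have [] := lcrossE u v; rewrite /mink.
  move: (lcross u v) => n n0 n1 n2; case: (ord3P i) => ->.
  - exists (v 0 2%:R * n 0 1 - v 0 1 * n 0 2%:R), (u 0 1 * n 0 2%:R - u 0 2%:R * n 0 1).
    by exists (n 0 0); rewrite n0 n1 n2; ring.
  - exists (v 0 2%:R * n 0 0 - v 0 0 * n 0 2%:R), (u 0 0 * n 0 2%:R - u 0 2%:R * n 0 0).
    by exists (n 0 1); rewrite n0 n1 n2; ring.
  - exists (v 0 0 * n 0 1 - v 0 1 * n 0 0), (u 0 1 * n 0 0 - u 0 0 * n 0 1).
    by exists (n 0 2%:R); rewrite n0 n1 n2; ring.
apply/rowP => i; rewrite mxE; have := h i; rewrite nn.
by rewrite mulr1.
Qed.

End ConstantCurvature.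

(** * Curves of constant curvature in closed form *)

Section CurveFormula.
Context {R : realType}.
Implicit Types (x t a b k : R) (u v w : 'rV[R]_3).
#[local] Existing Instance is_derive_sn.
#[local] Existing Instance is_derive_cs.

(** The primitive of [sn x] that vanishes at 0. Written through the half
    argument, it is the excess over 1 of the hyperbolic cosine of the distance
    between two points at arc length distance [t]. *)
Definition gn x t : R := 2 * sn x (t / 2) ^+ 2.

(** A polynomial identity that holds modulo two equations, given the cofactors. *)
Lemma lincomb2 (l1 r1 l2 r2 c1 c2 p q : R) : l1 = r1 -> l2 = r2 ->
  p - q = c1 * (l1 - r1) + c2 * (l2 - r2) -> p = q.
Proof. by move=> -> ->; rewrite !subrr !mulr0 addr0 => /eqP; rewrite subr_eq0 => /eqP. Qed.

Lemma half_half t : t / 2 + t / 2 = t. Proof. by field. Qed.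

Lemma sn_half x t : sn x t = 2 * (sn x (t / 2) * cs x (t / 2)).
Proof. by rewrite -[in LHS](half_half t) snD; ring. Qed.

Lemma cs_gn x t : cs x t = 1 + x * gn x t.
Proof. by rewrite -[in LHS](half_half t) csD -expr2 cs2 /gn; ring. Qed.

Lemma sn2_gn x t : sn x t ^+ 2 = 2 * gn x t + x * gn x t ^+ 2.
Proof. by rewrite sn_half !exprMn cs2 /gn; ring. Qed.

Lemma gn0 x : gn x 0 = 0.
Proof. by rewrite /gn mul0r sn0 expr0n mulr0. Qed.

Lemma gnB x a b : gn x (a - b) =
  gn x a + gn x b + x * (gn x a * gn x b) - sn x a * sn x b.
Proof.
rewrite [sn x a]sn_half [sn x b]sn_half /gn.
have -> : (a - b) / 2 = a / 2 - b / 2 by field.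
rewrite snB.
have -> : 2 * (sn x (a / 2) * cs x (b / 2) - cs x (a / 2) * sn x (b / 2)) ^+ 2 =
  2 * (sn x (a / 2) ^+ 2 * cs x (b / 2) ^+ 2 + cs x (a / 2) ^+ 2 * sn x (b / 2) ^+ 2)
  - 2 * (sn x (a / 2) * cs x (a / 2)) * (2 * (sn x (b / 2) * cs x (b / 2))) by ring.
by rewrite !cs2; ring.
Qed.

Lemma is_derive_gn x t : is_derive t (1 : R) (gn x) (sn x t).
Proof.
have h := is_derive_scaled (is_derive_sn x (2^-1 * t)).
have -> : gn x = 2 \*: ((fun s => sn x (2^-1 * s)) * (fun s => sn x (2^-1 * s))).
  by apply/funext => s; rewrite /gn [s / 2]mulrC expr2.
apply: is_derive_eq; rewrite [sn x t]sn_half [t / 2]mulrC /GRing.scale /=.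
by field.
Qed.
#[local] Existing Instance is_derive_gn.

(** The curve of curvature [k] with initial point [u], tangent [v] and normal [w],
    when [(u, v, w)] is a frame and [x = 1 - k ^+ 2]. *)
Definition curve_at x k u v w t : 'rV[R]_3 :=
  (1 + gn x t) *: u + sn x t *: v + (k * gn x t) *: w.

Lemma mink_curve_at k u v w a b : frame u v w ->
  mink (curve_at (1 - k ^+ 2) k u v w a) (curve_at (1 - k ^+ 2) k u v w b) =
  - (1 + gn (1 - k ^+ 2) (a - b)).
Proof.
move=> [uu vv ww [uv uw vw]]; rewrite /curve_at gnB.
move: (gn _ a) (gn _ b) (sn _ a) (sn _ b) => ga gb sa sb.
have -> : mink ((1 + ga) *: u + sa *: v + (k * ga) *: w)
   ((1 + gb) *: u + sb *: v + (k * gb) *: w) =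
   (1 + ga) * (1 + gb) * mink u u + sa * sb * mink v v + k * ga * (k * gb) * mink w w
   + ((1 + ga) * sb + sa * (1 + gb)) * mink u v
   + ((1 + ga) * (k * gb) + k * ga * (1 + gb)) * mink u w
   + (sa * (k * gb) + k * ga * sb) * mink v w.
  by rewrite /mink !mxE; ring.
by rewrite uu vv ww uv uw vw; ring.
Qed.

Lemma is_derive_coord (g : R -> 'rV[R]_3) t i : derivable g t 1 ->
  is_derive t (1 : R) (fun s => g s 0 i) (derive1 g t 0 i).
Proof.
move=> dg; have /derivable_mxP/(_ 0 i) di := dg.
by apply: DeriveDef => //; rewrite derive1E derive_mx// mxE.
Qed.

Lemma is_derive_minor (p q r s m : R -> R) k t (p' q' r' s' m' : R) :
  is_derive t (1 : R) p p' -> is_derive t (1 : R) q q' ->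
  is_derive t (1 : R) r r' -> is_derive t (1 : R) s s' ->
  is_derive t (1 : R) m m' ->
  is_derive t (1 : R) (fun t => p t * q t - r t * s t + k * m t)
    (p' * q t + p t * q' - (r' * s t + r t * s') + k * m').
Proof.
move=> dp dq dr ds dm.
apply: (trigger_derive (is_deriveD (is_deriveB (is_deriveM dp dq)
  (is_deriveM dr ds)) (is_deriveZ k dm))).
by rewrite /GRing.scale /=; ring.
Qed.

Lemma is_derive_mink (g h g' h' : R -> 'rV[R]_3) t :
  (forall i, is_derive t (1 : R) (fun s => g s 0 i) (g' t 0 i)) ->
  (forall i, is_derive t (1 : R) (fun s => h s 0 i) (h' t 0 i)) ->
  is_derive t (1 : R) (fun s => mink (g s) (h s))
    (mink (g' t) (h t) + mink (g t) (h' t)).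
Proof.
move=> dg dh; rewrite /mink.
have E (p q r s m n : R -> R) (p' q' r' s' m' n' : R) :
  is_derive t (1 : R) p p' -> is_derive t (1 : R) q q' ->
  is_derive t (1 : R) r r' -> is_derive t (1 : R) s s' ->
  is_derive t (1 : R) m m' -> is_derive t (1 : R) n n' ->
  is_derive t (1 : R) (fun t => - (p t * q t) + r t * s t + m t * n t)
    (- (p' * q t) + r' * s t + m' * n t + (- (p t * q') + r t * s' + m t * n')).
  move=> dp dq dr ds dm dn.
  apply: (trigger_derive (is_deriveD (is_deriveD (is_deriveN (is_deriveM dp dq))
    (is_deriveM dr ds)) (is_deriveM dm dn))).
  by rewrite /GRing.scale /=; ring.
exact: E.
Qed.

(** Both [cs v - x sn u - e sn] and [cs u - sn v + e gn] are constant; solving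
    for [u] uses [cs ^ 2 - x sn ^ 2 = 1]. *)
Lemma linear_ode (u v : R -> R) x e : (forall t, is_derive t (1 : R) u (v t)) ->
  (forall t, is_derive t (1 : R) v (x * u t + e)) ->
  forall t, u t = cs x t * u 0 + sn x t * v 0 + e * gn x t.
Proof.
move=> du dv t.
have A s : cs x s * v s - x * (sn x s * u s) - e * sn x s = v 0.
  transitivity (cs x 0 * v 0 - x * (sn x 0 * u 0) - e * sn x 0); last first.
    by rewrite sn0 cs0; ring.
  apply: (@is_derive_0_is_cst R
    (fun s => cs x s * v s - x * (sn x s * u s) - e * sn x s)) => r.
  apply: (trigger_derive (is_deriveB (is_deriveB
    (is_deriveM (is_derive_cs x r) (dv r))
    (is_deriveZ x (is_deriveM (is_derive_sn x r) (du r))))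
    (is_deriveZ e (is_derive_sn x r)))).
  by rewrite /GRing.scale /=; ring.
have B s : cs x s * u s - sn x s * v s + e * gn x s = u 0.
  transitivity (cs x 0 * u 0 - sn x 0 * v 0 + e * gn x 0); last first.
    by rewrite sn0 cs0 gn0; ring.
  apply: (@is_derive_0_is_cst R
    (fun s => cs x s * u s - sn x s * v s + e * gn x s)) => r.
  apply: (trigger_derive (is_deriveD (is_deriveB
    (is_deriveM (is_derive_cs x r) (du r))
    (is_deriveM (is_derive_sn x r) (dv r)))
    (is_deriveZ e (is_derive_gn x r)))).
  by rewrite /GRing.scale /=; ring.
have e1 := cs2 x t; have e2 := sn2_gn x t; have e3 := cs_gn x t.
rewrite -(A t) -(B t).
apply: (lincomb2 (c1 := - u t) (c2 := e) e1 e2).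
by rewrite e3; ring.
Qed.

Lemma minkC u v : mink u v = mink v u.
Proof. by rewrite /mink; ring. Qed.

(** Differentiating the two normalizations gives the products of the
    acceleration with point and tangent; the curvature is its product with the
    normal. *)
Lemma frenet (g g' g2 : R -> 'rV[R]_3) k :
  (forall t i, is_derive t (1 : R) (fun s => g s 0 i) (g' t 0 i)) ->
  (forall t i, is_derive t (1 : R) (fun s => g' s 0 i) (g2 t 0 i)) ->
  (forall t, mink (g t) (g t) = -1) -> (forall t, mink (g' t) (g' t) = 1) ->
  (forall t, det3 (g t) (g' t) (g2 t) = k) ->
  forall t, mink (g t) (g' t) = 0 /\ g2 t = g t + k *: lcross (g t) (g' t).
Proof.
move=> Dg Dg' cc nv curv.
have Dcst (f : R -> R) (d e : R) t : is_derive t (1 : R) f d -> (forall s, f s = e) -> d = 0.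
  move=> [_ <-] fe; have -> : f = cst e by apply/funext.
  by rewrite derive_cst.
have cv t : mink (g t) (g' t) = 0.
  have := Dcst _ _ _ _ (is_derive_mink (Dg t) (Dg t)) cc.
  by rewrite [mink (g' t) _]minkC; lra.
have ca t : mink (g t) (g2 t) = -1.
  by have := Dcst _ _ _ _ (is_derive_mink (Dg t) (Dg' t)) cv; rewrite nv; lra.
have va t : mink (g' t) (g2 t) = 0.
  have := Dcst _ _ _ _ (is_derive_mink (Dg' t) (Dg' t)) nv.
  by rewrite [mink (g2 t) _]minkC; lra.
move=> t; split=> //.
have [_ _ nn [_ un vn]] := lcross_frame (cc t) (nv t) (cv t).
apply/eqP; rewrite -subr_eq0; apply/eqP.
have mB u u' v w : mink (u - (u' + k *: v)) w = mink u w - mink u' w - k * mink v w.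
  by rewrite /mink !mxE; ring.
apply: (frame_expand (cc t) (nv t) (cv t)); rewrite mB.
- by rewrite minkC ca cc minkC un; ring.
- by rewrite minkC va cv minkC vn; ring.
- rewrite un nn -(curv t) det3E /mink.
  by have [-> -> ->] := lcrossE (g t) (g' t); ring.
Qed.

(** The vector n + k g, with n the normal, is constant: the tangential parts of
    its derivative cancel. It is the normal of the affine plane that contains
    the curve. *)
Lemma binormal_cst (g g' g2 : R -> 'rV[R]_3) k :
  (forall t i, is_derive t (1 : R) (fun s => g s 0 i) (g' t 0 i)) ->
  (forall t i, is_derive t (1 : R) (fun s => g' s 0 i) (g2 t 0 i)) ->
  (forall t, mink (g t) (g t) = -1) ->
  (forall t, mink (g t) (g' t) = 0) ->
  (forall t, g2 t = g t + k *: lcross (g t) (g' t)) ->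
  forall t i, lcross (g t) (g' t) 0 i + k * g t 0 i =
              lcross (g 0) (g' 0) 0 i + k * g 0 0 i.
Proof.
move=> Dg Dg' cc cv acc t i.
apply: (@is_derive_0_is_cst R (fun t => lcross (g t) (g' t) 0 i + k * g t 0 i)) => s.
have ai j : g2 s 0 j = g s 0 j + k * lcross (g s) (g' s) 0 j by rewrite acc !mxE.
have := cc s; have := cv s; rewrite /mink => cvs ccs.
have [ns0 ns1 ns2] := lcrossE (g s) (g' s).
case: (ord3P i) => ->.
- have -> : (fun t => lcross (g t) (g' t) 0 0 + k * g t 0 0) =
      (fun t => g t 0 2%:R * g' t 0 1 - g t 0 1 * g' t 0 2%:R + k * g t 0 0).
    by apply/funext => t'; have [-> _ _] := lcrossE (g t') (g' t').
  apply: (trigger_derive (is_derive_minor k (Dg s 2%:R) (Dg' s 1) (Dg s 1) (Dg' s 2%:R) (Dg s 0))); rewrite !ai ns1 ns2.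
  by apply: (lincomb2 (c1 := k * g' s 0 0) (c2 := - (k * g s 0 0)) ccs cvs); ring.
- have -> : (fun t => lcross (g t) (g' t) 0 1 + k * g t 0 1) =
      (fun t => g t 0 2%:R * g' t 0 0 - g t 0 0 * g' t 0 2%:R + k * g t 0 1).
    by apply/funext => t'; have [_ -> _] := lcrossE (g t') (g' t').
  apply: (trigger_derive (is_derive_minor k (Dg s 2%:R) (Dg' s 0) (Dg s 0) (Dg' s 2%:R) (Dg s 1))); rewrite !ai ns0 ns2.
  by apply: (lincomb2 (c1 := k * g' s 0 1) (c2 := - (k * g s 0 1)) ccs cvs); ring.
- have -> : (fun t => lcross (g t) (g' t) 0 2%:R + k * g t 0 2%:R) =
      (fun t => g t 0 0 * g' t 0 1 - g t 0 1 * g' t 0 0 + k * g t 0 2%:R).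
    by apply/funext => t'; have [_ _ ->] := lcrossE (g t') (g' t').
  apply: (trigger_derive (is_derive_minor k (Dg s 0) (Dg' s 1) (Dg s 1) (Dg' s 0) (Dg s 2%:R))); rewrite !ai ns0 ns1.
  by apply: (lincomb2 (c1 := k * g' s 0 2%:R) (c2 := - (k * g s 0 2%:R)) ccs cvs); ring.
Qed.

(** Each coordinate satisfies u'' = x u + e with e a coordinate of the constant
    vector of [binormal_cst], times k. *)
Lemma constant_curvature_curve_formula (c : R -> H2 R) k :
  constant_curvature_curve c k -> exists u v w, frame u v w /\
    forall t, c t = curve_at (1 - k ^+ 2) k u v w t :> 'rV[R]_3.
Proof.
rewrite /constant_curvature_curve /= => -[dg dg' nv curv].
have cc t : mink (c t) (c t) = -1 by have /andP[/eqP] := H2P (c t).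
have Dg t i := is_derive_coord i (dg t).
have Dg' t i := is_derive_coord i (dg' t).
move: (derive1 _) Dg Dg' nv curv {dg dg'} => g' Dg.
move: (derive1 _) => g2 Dg' nv curv.
have acc := frenet Dg Dg' cc nv curv.
have cv t := (acc t).1.
have {}acc t := (acc t).2.
exists (c 0), (g' 0), (lcross (c 0) (g' 0)); split; first exact: lcross_frame.
move=> t; apply/rowP => i.
have V := binormal_cst Dg Dg' cc cv acc.
have ode s : is_derive s (1 : R) (fun t => g' t 0 i)
    ((1 - k ^+ 2) * c s 0 i + k * (lcross (c 0) (g' 0) 0 i + k * c 0 0 i)).
  by apply: (trigger_derive (Dg' s i)); rewrite acc -(V s i); move: (lcross _ _) => n; rewrite !mxE; ring.
rewrite (linear_ode (Dg ^~ i) ode).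
by rewrite !mxE cs_gn; ring.
Qed.

End CurveFormula.

(** * From polygons to half arcs *)

Section Arcs.
Context {R : realType}.
Implicit Types (x t a b k : R) (u v w : 'rV[R]_3).

Lemma H2_inj (p q : H2 R) : H2val p = H2val q -> p = q.
Proof.
case: p q => [u hu] [v hv] /= uv; rewrite uv in hu *.
by congr MkH2; exact: bool_irrelevance.
Qed.

Lemma sn_half_period x t : x < 0 -> sn x (t + pi / Num.sqrt `|x|) = - sn x t.
Proof.
move=> x0; rewrite !sn_neg// mulrDr mulrCA divff ?mulr1 ?sinDpi ?mulNr//.
by rewrite gt_eqF// sqrt_norm_gt0// ltr0_neq0.
Qed.

Lemma curve_at_period x k u v w t : x < 0 ->
  curve_at x k u v w (t + 2 * (pi / Num.sqrt `|x|)) = curve_at x k u v w t.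
Proof.
move=> x0; rewrite /curve_at /gn.
have -> : (t + 2 * (pi / Num.sqrt `|x|)) / 2 = t / 2 + pi / Num.sqrt `|x|.
  by field; rewrite gt_eqF// sqrt_norm_gt0// ltr0_neq0.
have -> : t + 2 * (pi / Num.sqrt `|x|) =
  t + pi / Num.sqrt `|x| + pi / Num.sqrt `|x| by ring.
by rewrite !sn_half_period// opprK sqrrN.
Qed.

Lemma cs1E t : cs 1 t = (expR t + expR (- t)) / 2.
Proof. by rewrite /cs ltr10 oner_eq0 normr1 sqrtr1 mul1r. Qed.

Lemma short_ge0 x t : 0 <= x -> 0 < t -> short x t.
Proof. by move=> x0 t0; split=> // /(le_lt_trans x0); rewrite ltxx. Qed.

Lemma sn_ge0_mono x a b : 0 <= x -> 0 <= a -> (sn x a < sn x b) = (a < b).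
Proof.
move=> x0 a0; have lt c d : 0 <= c -> c < d -> sn x c < sn x d.
  move=> c0 cd; have d0 := le_lt_trans c0 cd.
  by apply: sn_lt => //; [exact: short_ge0|exact/ltW/cs_gt0].
apply/idP/idP => [|/(lt _ _ a0)//].
apply: contraTT; rewrite -!leNgt le_eqVlt => /orP[/eqP->//|ba].
have [b0|b0] := leP 0 b; first by rewrite ltW// lt.
apply: (@le_trans _ _ 0); last first.
  by move: a0; rewrite le_eqVlt => /orP[/eqP<-|a0]; rewrite ?sn0// ltW// sn_gt0//; exact: short_ge0.
rewrite -[b]opprK snN oppr_le0 ltW// sn_gt0//; apply: short_ge0 => //.
by rewrite oppr_gt0.
Qed.

Lemma arcosh_half (y : R) : 0 <= y ->
  0 <= arcosh (1 + 2 * y ^+ 2) /\ sn 1 (arcosh (1 + 2 * y ^+ 2) / 2) = y.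
Proof.
move=> y0; set v := 1 + 2 * y ^+ 2.
have v1 : 1 <= v by rewrite lerDl mulr_ge0// sqr_ge0.
have q0 : 0 <= v ^+ 2 - 1.
  by rewrite subr_ge0 -[leLHS](expr1n _ 2) lerXn2r// nnegrE ?ler01// (le_trans ler01).
set r := Num.sqrt (v ^+ 2 - 1).
have r0 : 0 <= r by rewrite sqrtr_ge0.
have vr : 1 <= v + r by rewrite (le_trans v1)// lerDl.
have vr0 : 0 < v + r by rewrite (lt_le_trans _ vr).
have l0 : 0 <= arcosh v by rewrite /arcosh ln_ge0.
split=> //.
have e : expR (arcosh v) = v + r by rewrite lnK// posrE.
have e' : expR (- arcosh v) = v - r.
  rewrite expRN e; apply: (mulfI (lt0r_neq0 vr0)); rewrite divff ?lt0r_neq0//.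
  have -> : (v + r) * (v - r) = v ^+ 2 - r ^+ 2 by ring.
  by rewrite sqr_sqrtr//; ring.
have : cs 1 (arcosh v) = v by rewrite cs1E e e'; field.
rewrite cs_gn /gn mul1r /v => /addrI /(mulfI (lt0r_neq0 (ltr0Sn R 1))) /eqP.
rewrite -/v eqf_sqr => /orP[/eqP//|/eqP sy].
have : 0 <= sn 1 (arcosh v / 2).
  move: l0; rewrite le_eqVlt => /orP[/eqP<-|l0]; first by rewrite mul0r sn0.
  by rewrite ltW// sn_gt0//; apply: short_ge0 => //; rewrite divr_gt0.
rewrite sy oppr_ge0 => yle.
by have -> : y = 0; [apply/le_anti/andP; split|rewrite oppr0].
Qed.

(** The half arc formula for distances: since [sn 1] is the hyperbolic sine, a
    chord with [- mink p q = 1 + 2 y ^+ 2] has length l >= 0 iff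
    y = sinh (l / 2). *)
Lemma hdist_half (p q : H2 R) (y l : R) : 0 <= y -> mink p q = - (1 + 2 * y ^+ 2) ->
  (hdist p q = l) <-> (0 <= l /\ y = sn 1 (l / 2)).
Proof.
move=> y0 pq; rewrite /hdist pq opprK; have [h0 hy] := arcosh_half y0; split.
  by move=> <-.
move=> [l0 yl]; rewrite yl in hy.
apply/le_anti/andP; split; rewrite leNgt; apply/negP => h.
  have : sn 1 (l / 2) < sn 1 (arcosh (1 + 2 * y ^+ 2) / 2).
    by rewrite sn_ge0_mono//; [rewrite ltr_pM2r// invr_gt0|rewrite divr_ge0].
  by rewrite yl hy ltxx.
have : sn 1 (arcosh (1 + 2 * y ^+ 2) / 2) < sn 1 (l / 2).
  by rewrite sn_ge0_mono//; [rewrite ltr_pM2r// invr_gt0|rewrite divr_ge0].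
by rewrite yl hy ltxx.
Qed.

Variable N : nat.
Implicit Types (P : nat -> H2 R) (s m : nat).

(** The n-periodic extension to nat, n = N + 1, of a family indexed by the
    cyclically ordered vertices; it turns the cyclic successor into [S]. *)
Definition cyc (T : Type) (f : 'I_N.+1 -> T) (i : nat) : T := f (inord (i %% N.+1)).

Lemma cyc_ord T (f : 'I_N.+1 -> T) (i : 'I_N.+1) : cyc f i = f i.
Proof. by rewrite /cyc modn_small ?inord_val. Qed.

Lemma cycE T (f : 'I_N.+1 -> T) i j : i = j %[mod N.+1] -> cyc f i = cyc f j.
Proof. by rewrite /cyc => ->. Qed.

Lemma ordSE (i : 'I_N.+1) : ordS i = inord (i.+1 %% N.+1).
Proof. by apply: val_inj; rewrite /= inordK// ltn_pmod. Qed.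

Lemma cyc_ordS T (f : 'I_N.+1 -> T) (i : nat) :
  f (ordS (inord (i %% N.+1))) = cyc f i.+1.
Proof.
by rewrite ordSE /cyc inordK ?ltn_pmod// -addn1 modnDml addn1.
Qed.

Lemma cyc_iter T (f : 'I_N.+1 -> T) s (i : 'I_N.+1) :
  f (iter s (@ordS N.+1) i) = cyc f (s + i).
Proof.
suff -> : iter s (@ordS N.+1) i = inord ((s + i) %% N.+1) by [].
elim: s => [|s IH]; first by rewrite add0n modn_small// inord_val.
by rewrite iterS IH ordSE inordK ?ltn_pmod// -[(_ %% _).+1]addn1 modnDml addn1.
Qed.

(** Half of the arc length parameters of the vertices [P s], ..., [P (s + N)]
    on a curve with [x = 1 - kappa ^+ 2]. The Gram matrix is all that is kept of
    the positions: it determines the polygon up to isometries. *)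
Definition arcs x P s (t : nat -> R) :=
  [/\ forall i j, (i < j <= N)%N -> t i < t j,
      short x (t N - t 0%N)
    & forall i j, (i <= N)%N -> (j <= N)%N ->
      mink (P (s + i)%N) (P (s + j)%N) = - (1 + 2 * sn x (t j - t i) ^+ 2)].

(** On a circle the injectivity of the parametrization bounds the parameters by
    one period; this is what makes the half arcs [short]. *)
Lemma cyclic_polygon_arcs (p : 'I_N.+1 -> H2 R) : (0 < N)%N ->
  (exists c k, [/\ k != 0, constant_curvature_curve c k & occur_in_order p c]) ->
  exists k s (t : nat -> R), k != 0 /\ arcs (1 - k ^+ 2) (cyc p) s t.
Proof.
move=> N0 [c [k [k0 cc [a [b [t [s [cinj tab tlt pt]]]]]]]].
have [u [v [w [fr cE]]]] := constant_curvature_curve_formula cc.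
exists k, s, (fun i => t (inord i) / 2); split=> //; split.
- move=> i j /andP[ij jN]; rewrite ltr_pM2r ?invr_gt0// tlt//.
  by rewrite !inordK// ltnS// ltnW// (leq_trans ij).
- have tl : t (inord 0) < t (inord N) by rewrite tlt// !inordK.
  split; first by rewrite -mulrBl divr_gt0// subr_gt0.
  move=> x0; rewrite ltNge; apply/negP => hpi.
  have w0 := sqrt_norm_gt0 (ltr0_neq0 x0).
  set T := pi / Num.sqrt `|1 - k ^+ 2|.
  have T0 : 0 < T by rewrite divr_gt0// pi_gt0.
  (* 2 T is a period of the curve, so a and a + 2 T would be two parameters of
     one point. *)
  have Tle : a + 2 * T <= b.
    have : 2 * T <= t (inord N) - t (inord 0).
      rewrite mulrC -ler_pdivlMr// mulrBl.
      by rewrite /T ler_pdivrMr// mulrC.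
    have := tab (inord N); have := tab (inord 0); rewrite !in_itv /=.
    by move=> /andP[? ?] /andP[? ?]; lra.
  have ab : a \in `[a, b] by rewrite in_itv /= lexx; lra.
  have abT : a + 2 * T \in `[a, b] by rewrite in_itv /= Tle andbT; lra.
  have : a = a + 2 * T.
    by apply: cinj => //; apply: H2_inj; rewrite !cE curve_at_period.
  by lra.
- move=> i j iN jN.
  have pE q : (q <= N)%N -> cyc p (s + q) = c (t (inord q)).
    by move=> qN; rewrite -pt cyc_iter inordK.
  rewrite !pE// minkC !cE mink_curve_at// /gn.
  by congr (- (1 + 2 * sn _ _ ^+ 2)); rewrite mulrBl.
Qed.

Lemma arcs_mod x P s s' (t : nat -> R) : (forall i j, i = j %[mod N.+1] -> P i = P j) ->
  s = s' %[mod N.+1] -> arcs x P s t -> arcs x P s' t.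
Proof.
move=> hP ss [h1 h2 h3]; split=> // i j iN jN; rewrite -h3//.
by congr mink; congr H2val; apply: hP; rewrite -modnDml -ss modnDml.
Qed.

(** On a circle the first vertex may be moved to the end by adding a half period
    to its half arc, so that every cyclic shift of the labels is allowed. *)
Lemma arcs_succ x P s (t : nat -> R) : (0 < N)%N -> x < 0 ->
  (forall i j, i = j %[mod N.+1] -> P i = P j) ->
  arcs x P s t -> exists t' : nat -> R, arcs x P s.+1 t'.
Proof.
move=> N0 x0 hP [h1 [h2 h3] h4].
have w0 := sqrt_norm_gt0 (ltr0_neq0 x0).
set T := pi / Num.sqrt `|x|.
have tT : t N - t 0%N < T by rewrite /T ltr_pdivlMr// mulrC; exact: h3.
have tm i j : (i <= j <= N)%N -> t i <= t j.
  move=> /andP[]; rewrite leq_eqVlt => /orP[/eqP-> //|ij jN].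
  by rewrite ltW// h1// ij.
pose t' i := if (i < N)%N then t i.+1 else t 0%N + T.
exists t'; split.
- move=> i j /andP[ij jN]; rewrite /t' (leq_trans ij jN).
  case: ltnP => jN'; first by rewrite h1// ltnS ij.
  by apply: (@le_lt_trans _ _ (t N)); [rewrite tm//= leqnn andbT (leq_trans ij)|lra].
- rewrite /t' ltnn N0; split.
    by have := tm 1%N N; rewrite leqnn N0 => /(_ isT); lra.
  move=> _; have := h1 0%N 1%N; rewrite N0 => /(_ isT) t01.
  have : t 0%N + T - t 1%N < T by lra.
  by rewrite {2}/T ltr_pdivlMr// mulrC.
- have hPN : P (s.+1 + N)%N = P (s + 0)%N by apply: hP; rewrite addSnnS modnDr addn0.
  have sq i j : sn x (t j - t i) ^+ 2 = sn x (t i - t j) ^+ 2.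
    by rewrite -opprB snN sqrrN.
  move=> i j; rewrite /t' leq_eqVlt => /orP[/eqP->|iN].
    rewrite ltnn hPN leq_eqVlt => /orP[/eqP->|jN].
      by rewrite ltnn hPN h4// !subrr.
    rewrite jN addSnnS h4//.
    have -> : sn x (t j.+1 - (t 0%N + T)) ^+ 2 = sn x (t 0%N - t j.+1 + T) ^+ 2.
      by rewrite -sqrrN -snN; congr (sn _ _ ^+ 2); ring.
    by rewrite sn_half_period// sqrrN sq.
  rewrite iN leq_eqVlt => /orP[/eqP->|jN].
    rewrite ltnn hPN addSnnS h4//.
    have -> : t 0%N + T - t i.+1 = t 0%N - t i.+1 + T by ring.
    by rewrite sn_half_period// sqrrN.
  by rewrite jN !addSnnS h4.
Qed.

Lemma arcs_any x P s s' (t : nat -> R) : (0 < N)%N -> x < 0 ->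
  (forall i j, i = j %[mod N.+1] -> P i = P j) ->
  arcs x P s t -> exists t' : nat -> R, arcs x P s' t'.
Proof.
move=> N0 x0 hP h.
have sj : s + (N * s + s') = s' %[mod N.+1].
  by rewrite addnA -mulSn -modnDml mulnC modnMl add0n.
move: (N * s + s')%N sj => j sj.
suff [t' ht'] : exists t' : nat -> R, arcs x P (s + j) t'.
  by exists t'; apply: arcs_mod ht'.
elim: j {sj} => [|j [t' IH]]; first by exists t; rewrite addn0.
by rewrite addnS; apply: arcs_succ IH.
Qed.

Lemma arcs_side x P s (t : nat -> R) i (l : R) : (i < N)%N ->
  arcs x P s t -> hdist (P (s + i)%N) (P (s + i).+1) = l ->
  sn x (t i.+1 - t i) = sn 1 (l / 2).
Proof.
move=> iN [h1 h2 h3]; have := h3 i i.+1 (ltnW iN) iN; rewrite addnS => e.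
have sx : short x (t i.+1 - t i).
  apply: short_le h2; first by rewrite subr_gt0 h1// ltnSn.
  have a0 : t 0%N <= t i.
    by case: i {e} iN => // i iN; rewrite ltW// h1//= ltnW.
  have aN : t i.+1 <= t N.
    by move: iN; rewrite leq_eqVlt => /orP[/eqP->//|iN]; rewrite ltW// h1// iN /=.
  by lra.
by move/(hdist_half _ (ltW (sn_gt0 sx)) e) => -[].
Qed.

Lemma arcs_closing x P s (t : nat -> R) (l : R) : (0 < N)%N ->
  arcs x P s t -> hdist (P (s + N)%N) (P s) = l ->
  sn x (t N - t 0%N) = sn 1 (l / 2).
Proof.
move=> N0 [h1 h2 h3]; have := h3 N 0%N (leqnn N) (leq0n _); rewrite addn0 => e.
have {}e : mink (P (s + N)%N) (P s) = - (1 + 2 * sn x (t N - t 0%N) ^+ 2).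
  by rewrite e -opprB snN sqrrN.
by move/(hdist_half _ (ltW (sn_gt0 h2)) e) => -[].
Qed.

End Arcs.

(** * Rigidity and the polygon inequality *)

Section Rigidity.
Context {R : realType}.
Variable N : nat.
Hypothesis N1 : (1 < N)%N.
Implicit Types (x k : R) (p q : 'I_N.+1 -> H2 R) (l : 'I_N.+1 -> R) (m : 'I_N.+1).

Lemma side_cyc p l : has_side_lengths p l ->
  forall i, hdist (cyc p i) (cyc p i.+1) = cyc l i.
Proof. by move=> pl i; rewrite -cyc_ordS /cyc pl. Qed.

Lemma half_mono (a b : R) : 0 <= a -> a <= b -> sn 1 (a / 2) <= sn 1 (b / 2).
Proof.
move=> a0 ab; rewrite leNgt sn_ge0_mono//; last by rewrite divr_ge0// (le_trans a0).
by rewrite -leNgt ler_pM2r// invr_gt0.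
Qed.

Lemma sum_cyc l m : \sum_(i < N) cyc l (m.+1 + i) = \sum_(i < N.+1 | i != m) l i.
Proof.
have e : \sum_(i < N.+1) cyc l (m.+1 + i) = \sum_i l i.
  rewrite [RHS](reindex_inj (addrI (inZp m.+1))); apply: eq_bigr => i _.
  rewrite /cyc; congr l; apply: val_inj.
  by rewrite /= inordK ?ltn_pmod// modnDml.
move: e; rewrite big_ord_recr /= [RHS](bigD1 m)//= addrC.
have -> : cyc l (m.+1 + N) = l m.
  by rewrite -(cyc_ord l m); apply: cycE; rewrite addSnnS modnDr.
by move/addrI.
Qed.

(** On a horocycle or hypercycle the closing side spans all the others and is
    therefore the longest one, which forces the cyclic shift; on a circle the
    shift is free. Hence the polygon can always be cut at a longest side [m]. *)
Lemma arcs_at_longest p l m : (forall i, l i <= l m) -> (forall i, 0 < l i) ->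
  cyclic_polygon p -> has_side_lengths p l ->
  exists k (t : nat -> R), k != 0 /\ arcs N (1 - k ^+ 2) (cyc p) m.+1 t.
Proof.
move=> lm l0 [_ cp] pl; have N0 := ltnW N1.
have [k [s [t [k0 ht]]]] := cyclic_polygon_arcs N0 cp.
exists k; have [x0|x0] := ltP (1 - k ^+ 2) 0.
  have [t' ht'] := arcs_any m.+1 N0 x0 (@cycE _ _ p) ht.
  by exists t'.
exists t; split=> //; apply: (arcs_mod _ _ ht); first exact: cycE.
set i := ((m + N * s) %% N.+1)%N.
have si : s + i = m %[mod N.+1].
  by rewrite modnDmr addnCA -mulSn addnC mulnC modnMDl.
have iN : (i <= N)%N by rewrite -ltnS ltn_pmod.
move: iN; rewrite leq_eqVlt => /orP[/eqP iN|iN].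
  move: si; rewrite iN => /(congr1 (fun a => (a.+1 %% N.+1)%N)).
  by rewrite -[(_ %% _).+1]addn1 -[((m %% _).+1)]addn1 !modnDml !addn1 -addnS modnDr.
have e1 := arcs_side iN ht (side_cyc pl _).
have e2 := arcs_closing N0 ht.
have /e2{}e2 : hdist (cyc p (s + N)) (cyc p s) = cyc l (s + N).
  by rewrite -(side_cyc pl) (@cycE _ _ p s (s + N).+1)// -addnS modnDr.
have [h1 _ _] := ht.
have ti : t i < t i.+1 by rewrite h1// ltnSn.
have : sn (1 - k ^+ 2) (t i.+1 - t i) < sn (1 - k ^+ 2) (t N - t 0%N).
  rewrite sn_ge0_mono; [|exact: x0|by rewrite subr_ge0 ltW].
  case: (posnP i) => [i0|i0].
    by rewrite i0 ltrD2r h1// N1 leqnn.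
  have := h1 0%N i; rewrite i0 (ltnW iN) => /(_ isT) t0i.
  suff : t i.+1 <= t N by lra.
  by move: iN; rewrite leq_eqVlt => /orP[/eqP->//|iN]; rewrite ltW// h1// iN leqnn.
rewrite e1 e2 (cycE _ si) cyc_ord ltNge half_mono//; last exact: lm.
exact/ltW/l0.
Qed.

(** A half arc beyond the quarter period would belong to a side longer than the
    closing one, because the total half arc is larger still and [sn x] decreases
    there. *)
Lemma arcs_arm p l m x (t : nat -> R) :
  (forall i, l i <= l m) -> (forall i, 0 < l i) -> has_side_lengths p l ->
  arcs N x (cyc p) m.+1 t ->
  [/\ arm x N (fun i => t i.+1 - t i),
      forall i, (i < N)%N -> sn x (t i.+1 - t i) = sn 1 (cyc l (m.+1 + i) / 2),
      forall i, t i = t 0%N + \sum_(j < i) (t j.+1 - t j)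
    & sn x (\sum_(j < N) (t j.+1 - t j)) = sn 1 (l m / 2)].
Proof.
move=> lm l0 pl ht; have N0 := ltnW N1.
have tsum i : t i = t 0%N + \sum_(j < i) (t j.+1 - t j).
  rewrite -(big_mkord xpredT (fun j => t j.+1 - t j)) telescope_sumr//.
  by rewrite addrC subrK.
have tN : \sum_(j < N) (t j.+1 - t j) = t N - t 0%N by rewrite (tsum N); ring.
have hs i : (i < N)%N -> sn x (t i.+1 - t i) = sn 1 (cyc l (m.+1 + i) / 2).
  by move=> iN; apply: (arcs_side iN ht); exact: side_cyc.
have hc : sn x (t N - t 0%N) = sn 1 (l m / 2).
  apply: (arcs_closing N0 ht).
  have -> : cyc p (m.+1 + N) = cyc p m by apply: cycE; rewrite addSnnS modnDr.
  by rewrite (side_cyc pl) cyc_ord.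
split=> //; last by rewrite tN.
have [h1 h2 _] := ht; split; last by rewrite tN.
move=> i iN; have ti : t i < t i.+1 by rewrite h1// ltnSn.
split; first by rewrite subr_gt0.
rewrite leNgt; apply/negP => ci.
have tlt : t i.+1 - t i < t N - t 0%N.
  case: (posnP i) => [i0|i0].
    by rewrite i0 ltrD2r h1// N1 leqnn.
  have := h1 0%N i; rewrite i0 (ltnW iN) => /(_ isT) t0i.
  suff : t i.+1 <= t N by lra.
  by move: iN; rewrite leq_eqVlt => /orP[/eqP->//|iN]; rewrite ltW// h1// iN leqnn.
have := sn_gt _ tlt h2 ci; rewrite subr_gt0 => /(_ ti).
rewrite hs// hc ltNge half_mono//; last exact: lm.
exact/ltW/l0.
Qed.

(** The arm lemma against [x = 1], the geodesic: there the half arcs are the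
    [l i / 2] themselves and the closing chord is the hyperbolic sine of their
    sum. *)
Lemma longest_lt_sum p l m : (forall i, l i <= l m) -> (forall i, 0 < l i) ->
  cyclic_polygon p -> has_side_lengths p l -> l m < \sum_(i < N.+1 | i != m) l i.
Proof.
move=> lm l0 cp pl.
have [k [t [k0 ht]]] := arcs_at_longest lm l0 cp pl.
have [ha hs _ hc] := arcs_arm lm l0 pl ht.
pose z i : R := cyc l (m.+1 + i) / 2.
have z0 i : 0 < z i by rewrite divr_gt0// l0.
have z1 : arm 1 N z.
  split; first by move=> i _; rewrite z0 ltW// cs_gt0.
  by apply: short_ge0 => //; apply: sum_gt0 => //; exact: ltnW.
have k1 : 1 - k ^+ 2 < 1 by rewrite gtrBl exprn_even_gt0.
have := arm_lemma k1 N1 ha z1 hs; rewrite hc sn_ge0_mono//; last first.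
  by rewrite divr_ge0// ltW.
by rewrite -mulr_suml ltr_pM2r ?invr_gt0// sum_cyc.
Qed.

(** If [x < x'] the arm lemma would give different closing chords for one and
    the same longest side; once [x = x'], half arcs within a quarter period are
    determined by their chords. *)
Lemma arcs_unique x x' p q l m (t t' : nat -> R) :
  (forall i, l i <= l m) -> (forall i, 0 < l i) ->
  has_side_lengths p l -> has_side_lengths q l ->
  arcs N x (cyc p) m.+1 t -> arcs N x' (cyc q) m.+1 t' ->
  x = x' /\ forall i, (i < N)%N -> t i.+1 - t i = t' i.+1 - t' i.
Proof.
move=> lm l0 pl ql ht ht'.
have [ha hs _ hc] := arcs_arm lm l0 pl ht.
have [ha' hs' _ hc'] := arcs_arm lm l0 ql ht'.
have xx : x = x'.
  have [xx|xx|//] := ltgtP x x'.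
    have := arm_lemma xx N1 ha ha'; rewrite hc hc' ltxx => h.
    by exfalso; apply: notF; apply: h => i iN; rewrite hs// hs'.
  have := arm_lemma xx N1 ha' ha; rewrite hc hc' ltxx => h.
  by exfalso; apply: notF; apply: h => i iN; rewrite hs// hs'.
split=> // i iN; rewrite -xx in ha' hs'.
apply: (@sn_inj_quarter _ x); [exact: (arm_short ha)|exact: (arm_short ha')| | |].
- by have [/(_ _ iN)[]] := ha.
- by have [/(_ _ iN)[]] := ha'.
- by rewrite hs// hs'.
Qed.

Lemma cyclic_polygon_gram p q l m : (forall i, l i <= l m) -> (forall i, 0 < l i) ->
  cyclic_polygon p -> has_side_lengths p l ->
  cyclic_polygon q -> has_side_lengths q l ->
  forall i j, mink (p i) (p j) = mink (q i) (q j).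
Proof.
move=> lm l0 cp pl cq ql.
have [k [t [_ ht]]] := arcs_at_longest lm l0 cp pl.
have [k' [t' [_ ht']]] := arcs_at_longest lm l0 cq ql.
have [xx tt] := arcs_unique lm l0 pl ql ht ht'.
have [_ _ ts _] := arcs_arm lm l0 pl ht.
have [_ _ ts' _] := arcs_arm lm l0 ql ht'.
have tt' i : (i <= N)%N -> t i - t 0%N = t' i - t' 0%N.
  move=> iN; rewrite (ts i) (ts' i) ![_ + _ - _]addrAC !subrr !add0r.
  by apply: eq_bigr => j _; rewrite tt// (leq_trans (ltn_ord j)).
have idx (i : 'I_N.+1) : exists2 a, (a <= N)%N & (m.+1 + a) = i %[mod N.+1].
  exists ((i + N * m.+1) %% N.+1)%N; first by rewrite -ltnS ltn_pmod.
  by rewrite modnDmr addnCA -mulSn addnC mulnC modnMDl.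
move=> i j; have [a aN ai] := idx i; have [b bN bj] := idx j.
rewrite -(cyc_ord p i) -(cyc_ord p j) -(cyc_ord q i) -(cyc_ord q j).
rewrite -!(cycE _ ai) -!(cycE _ bj).
have [_ _ h] := ht; have [_ _ h'] := ht'; rewrite h// h'// xx.
congr (- (1 + 2 * sn _ _ ^+ 2)).
by have := tt' a aN; have := tt' b bN; lra.
Qed.

End Rigidity.

(** * Congruence from equality of Gram matrices *)

Section Congruence.
Context {R : realType}.
Implicit Types (u v w : 'rV[R]_3) (P Q : 'M[R]_3).

Definition minkJ : 'M[R]_3 := \matrix_(i, j) ((i == j)%:R * (if i == 0 then -1 else 1)).

Lemma sum3 (f : 'I_3 -> R) : \sum_i f i = f 0 + f 1 + f 2%:R.
Proof.
rewrite !big_ord_recl big_ord0 addr0 addrA.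
by congr (_ + _ + _); congr f; apply: val_inj.
Qed.

Lemma minkJ_sqr : minkJ *m minkJ = 1%:M.
Proof.
apply/matrixP => i j; rewrite mxE sum3 !mxE.
by case: (ord3P i) => ->; case: (ord3P j) => -> /=; ring.
Qed.

Lemma minkE u v : mink u v = (u *m minkJ *m v^T) 0 0.
Proof.
rewrite /mink mxE sum3 !mxE !sum3 !mxE /=; ring.
Qed.

Lemma mink_gram P i j : mink (row i P) (row j P) = (P *m minkJ *m P^T) i j.
Proof.
rewrite minkE -row_mul mxE [RHS]mxE; apply: eq_bigr => k _.
by rewrite [row i _ _ _]mxE ![_^T _ _]mxE [row j _ _ _]mxE.
Qed.

Section Map.
Variables P Q : 'M[R]_3.
Hypotheses (uP : P \in unitmx) (uQ : Q \in unitmx).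
Hypothesis PQ : forall i j, mink (row i P) (row j P) = mink (row i Q) (row j Q).

Lemma gram_eq : P *m minkJ *m P^T = Q *m minkJ *m Q^T.
Proof. by apply/matrixP => i j; rewrite -!mink_gram PQ. Qed.

(** Equal Gram matrices P J P^T = Q J Q^T say that the linear map sending the
    rows of P to those of Q is a Lorentz transformation. *)
Lemma gram_map_mink u v :
  mink (u *m (invmx P *m Q)) (v *m (invmx P *m Q)) = mink u v.
Proof.
have e : invmx P *m Q *m minkJ *m (invmx P *m Q)^T = minkJ.
  rewrite trmx_mul !mulmxA -[invmx P *m Q *m _]mulmxA -[invmx P *m _ *m Q^T]mulmxA.
  rewrite -gram_eq !mulmxA mulVmx// mul1mx -mulmxA -trmx_mul mulVmx// trmx1 mulmx1.
  by [].
rewrite !minkE trmx_mul -[in RHS]e !mulmxA.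
by [].
Qed.

Lemma gram_map_eq u v : (forall i, mink u (row i P) = mink v (row i Q)) ->
  u *m (invmx P *m Q) = v.
Proof.
move=> h; set A := invmx P *m Q.
have PA : P *m A = Q by rewrite /A mulmxA mulmxV// mul1mx.
have uJ : minkJ \in unitmx by case: (mulmx1_unit minkJ_sqr).
have e : u *m A *m minkJ *m Q^T = v *m minkJ *m Q^T.
  apply/rowP => i.
  have mE w : (w *m minkJ *m Q^T) 0 i = mink w (row i Q).
    rewrite minkE mxE [RHS]mxE; apply: eq_bigr => k _.
    by rewrite ![_^T _ _]mxE [row i _ _ _]mxE.
  by rewrite !mE -h -PA row_mul gram_map_mink.
have uJQ : minkJ *m Q^T \in unitmx by rewrite unitmx_mul uJ unitmx_tr.
by apply: (can_inj (mulmxK uJQ)); rewrite (mulmxA (u *m A)) (mulmxA v) e.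
Qed.

End Map.

(** By the Cauchy-Schwarz inequality in the space coordinates, vectors of norm
    -1 lie on the same sheet iff their product is negative; this is how a
    Lorentz transformation is seen to preserve the upper sheet. *)
Lemma mink_lt0 u v : mink u u = -1 -> mink v v = -1 -> 0 < v 0 0 ->
  (0 < u 0 0) = (mink u v < 0).
Proof.
move=> uu vv v0.
have lt w : mink w w = -1 -> 0 < w 0 0 -> mink w v < 0.
  rewrite /mink => ww w0.
  have -> : - (w 0 0 * v 0 0) + w 0 1 * v 0 1 + w 0 2%:R * v 0 2%:R =
    (w 0 1 * v 0 1 + w 0 2%:R * v 0 2%:R) - w 0 0 * v 0 0 by ring.
  rewrite subr_lt0; set a := _ + _.
  have [a0|/ltW a0] := leP a 0; first by rewrite (le_lt_trans a0)// mulr_gt0.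
  rewrite -(@ltr_pXn2r _ 2)// ?nnegrE ?mulr_ge0 ?ltW//.
  have w2 : w 0 0 ^+ 2 = 1 + w 0 1 ^+ 2 + w 0 2%:R ^+ 2 by lra.
  have v2 : v 0 0 ^+ 2 = 1 + v 0 1 ^+ 2 + v 0 2%:R ^+ 2.
    by move: vv; rewrite /mink; lra.
  rewrite exprMn w2 v2 -subr_gt0 /a.
  have -> : (1 + w 0 1 ^+ 2 + w 0 2 ^+ 2) * (1 + v 0 1 ^+ 2 + v 0 2 ^+ 2) -
     (w 0 1 * v 0 1 + w 0 2 * v 0 2) ^+ 2 =
     1 + (w 0 1 ^+ 2 + w 0 2 ^+ 2 + v 0 1 ^+ 2 + v 0 2 ^+ 2 +
       (w 0 1 * v 0 2 - w 0 2 * v 0 1) ^+ 2) by ring.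
  by rewrite ltr_pwDl// !addr_ge0// sqr_ge0.
apply/idP/idP => [u0|h]; first exact: lt.
rewrite ltNge; apply/negP; rewrite le_eqVlt => /orP[/eqP u0|u0].
  by move: uu; rewrite /mink u0; nra.
have : mink (- u) v < 0.
  by apply: lt; [rewrite /mink !mxE; move: uu; rewrite /mink; lra|rewrite mxE oppr_gt0].
have -> : mink (- u) v = - mink u v by rewrite /mink !mxE; ring.
by rewrite oppr_lt0 => /(lt_trans h); rewrite ltxx.
Qed.

Lemma H2E (p : H2 R) : mink p p = -1 /\ 0 < (p : 'rV[R]_3) 0 0.
Proof. by have /andP[/eqP] := H2P p. Qed.

Lemma H2_mink_lt0 (p q : H2 R) : mink p q < 0.
Proof. by have [pp p0] := H2E p; have [qq q0] := H2E q; rewrite -mink_lt0. Qed.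

(** Three vertices off a common line are a basis of Minkowski space, so the
    Gram matrix against them determines every other vertex. *)
Lemma congruent_of_gram n (p q : 'I_n -> H2 R) (a b c : 'I_n) :
  det3 (p a) (p b) (p c) != 0 -> det3 (q a) (q b) (q c) != 0 ->
  (forall i j, mink (p i) (p j) = mink (q i) (q j)) -> congruent p q.
Proof.
move=> dp dq pq.
pose M (r : 'I_n -> H2 R) : 'M[R]_3 :=
  \matrix_(i < 3) tnth [tuple (r a : 'rV[R]_3); (r b : 'rV_3); (r c : 'rV_3)] i.
have uM (r : 'I_n -> H2 R) : det3 (r a) (r b) (r c) != 0 -> M r \in unitmx.
  by move=> dr; rewrite unitmxE unitfE.
have rMM (r r' : 'I_n -> H2 R) i : exists2 j, row i (M r) = r j & row i (M r') = r' j.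
  by rewrite !rowK; case: (ord3P i) => ->; [exists a|exists b|exists c].
have MM (r r' : 'I_n -> H2 R) : (forall i j, mink (r i) (r j) = mink (r' i) (r' j)) ->
    forall i j, mink (row i (M r)) (row j (M r)) = mink (row i (M r')) (row j (M r')).
  move=> rr i j; have [i' -> ->] := rMM r r' i; have [j' -> ->] := rMM r r' j.
  exact: rr.
have val (r r' : 'I_n -> H2 R) : det3 (r a) (r b) (r c) != 0 -> det3 (r' a) (r' b) (r' c) != 0 ->
    (forall i j, mink (r i) (r j) = mink (r' i) (r' j)) -> forall x : H2 R,
    (mink (x *m (invmx (M r) *m M r')) (x *m (invmx (M r) *m M r')) == -1) &&
    (0 < (x *m (invmx (M r) *m M r')) 0 0).
  move=> dr dr' rr x; have [xx x0] := H2E x.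
  have e := gram_map_mink (uM _ dr) (MM _ _ rr).
  have vv : mink (x *m (invmx (M r) *m M r')) (x *m (invmx (M r) *m M r')) = -1.
    by rewrite e.
  rewrite vv eqxx /=; have [aa a0] := H2E (r' a).
  rewrite (mink_lt0 vv aa a0).
  have <- : r a *m (invmx (M r) *m M r') = r' a.
    apply: (gram_map_eq (uM _ dr) (uM _ dr') (MM _ _ rr)) => i.
    by have [j -> ->] := rMM r r' i; exact: rr.
  by rewrite e H2_mink_lt0.
have qp i j : mink (q i) (q j) = mink (p i) (p j) by rewrite pq.
pose f x := MkH2 (val p q dp dq pq x); pose g x := MkH2 (val q p dq dp qp x).
exists f; split; last first.
  move=> k; apply: H2_inj => /=.
  apply: (gram_map_eq (uM _ dp) (uM _ dq) (MM _ _ pq)) => i.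
  by have [j -> ->] := rMM p q i; exact: pq.
split; last by move=> x y; rewrite /hdist /= (gram_map_mink (uM _ dp) (MM _ _ pq)).
exists g => x; apply: H2_inj; rewrite /= -!mulmxA.
  by rewrite (mulmxA (M q)) mulmxV ?uM// mul1mx mulVmx ?uM// mulmx1.
by rewrite (mulmxA (M p)) mulmxV ?uM// mul1mx mulVmx ?uM// mulmx1.
Qed.

End Congruence.

(** * Existence of the curvature *)

Section ClosingParameter.
Context {R : realType}.
Implicit Types (x t u e w b : R).
#[local] Existing Instance is_derive_sn.
#[local] Existing Instance is_derive_cs.
Local Open Scope classical_set_scope.

(** Up to scaling the argument and the value there are only three functions
    [sn e], with [e] one of -1, 0, 1; the scale [w] becomes the unknown. *)
Lemma sn_rescale e w t : 0 < w -> sn (e * w ^+ 2) t = sn e (w * t) / w.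
Proof.
move=> w0; have w2 : 0 < w ^+ 2 by rewrite exprn_gt0.
have q : Num.sqrt `|e * w ^+ 2| = Num.sqrt `|e| * w.
  by rewrite normrM sqrtrM// [`|w ^+ 2|]gtr0_norm// sqrtr_sqr (gtr0_norm w0).
rewrite /sn q pmulr_llt0// mulf_eq0 (gt_eqF w2) orbF.
have [e0|e0|e0] := ltgtP e 0.
- have s0 := sqrt_norm_gt0 (ltr0_neq0 e0).
  by rewrite !mulrA invfM mulrA.
- have s0 := sqrt_norm_gt0 (lt0r_neq0 e0).
  by rewrite !mulrA; field; rewrite !gt_eqF.
- by rewrite mulrC mulKf// gt_eqF.
Qed.

Lemma short_rescale e w t : 0 < w -> short e (w * t) -> short (e * w ^+ 2) t.
Proof.
move=> w0 [wt h]; split; first by rewrite pmulr_rgt0 in wt.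
rewrite pmulr_llt0 ?exprn_gt0// => /h.
by rewrite normrM sqrtrM// [`|w ^+ 2|]gtr0_norm ?exprn_gt0// sqrtr_sqr (gtr0_norm w0) -mulrA.
Qed.

Lemma sn_continuous e : continuous (sn e).
Proof.
by move=> t; apply/differentiable_continuous/derivable1_diffP; exact: ex_derive.
Qed.

Lemma sn_mvt e u : 0 < u -> exists2 c, 0 < c < u & sn e u = cs e c * u.
Proof.
move=> u0; have [|c] := @MVT R (sn e) (cs e) 0 u u0 (fun t _ => is_derive_sn e t).
  exact/continuous_subspaceT/sn_continuous.
by rewrite in_itv /= sn0 !subr0 => cu eq; exists c.
Qed.

Lemma sn1_ge u : 0 <= u -> u <= sn 1 u.
Proof.
rewrite le_eqVlt => /orP[/eqP<-|u0]; first by rewrite sn0.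
have [c _ ->] := sn_mvt 1 u0; rewrite ler_peMl ?(ltW u0)//.
rewrite -(@ler_pXn2r _ 2)// ?nnegrE ?ler01 ?(ltW (cs_gt0 _ _))//.
by rewrite expr1n cs2 mul1r lerDl sqr_ge0.
Qed.

Lemma snN1_le u : 0 <= u -> sn (- 1) u <= u.
Proof.
rewrite le_eqVlt => /orP[/eqP<-|u0]; first by rewrite sn0.
have [c _ ->] := sn_mvt (- 1) u0; rewrite ler_piMl ?(ltW u0)//.
by rewrite cs_neg ?ltrN10// cos_le1.
Qed.

Lemma right_pos (f : R -> R) d : is_derive (0 : R) (1 : R) f d -> f 0 = 0 -> 0 < d ->
  \forall h \near (0 : R)^'+, 0 < f h.
Proof.
move=> [df fd] f0 d0.
have : h^-1 *: (f (h *: 1 + 0) - f 0) @[h --> (0 : R)^'] --> d.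
  by rewrite -fd; exact: df.
move=> /cvgr_gt /(_ _ d0); rewrite f0 => hd.
have {}hd : \forall h \near (0 : R)^'+, 0 < h^-1 *: (f (h *: 1 + 0) - 0).
  move: hd; rewrite !near_withinE; apply: filterS => h hh h0.
  by apply: hh; rewrite gt_eqF.
near=> h; have h0 : 0 < h by near: h; exact: nbhs_right_gt.
have : 0 < h^-1 *: (f (h *: 1 + 0) - 0) by near: h.
by rewrite /GRing.scale /= mulr1 addr0 subr0 pmulr_rgt0 ?invr_gt0.
Unshelve. all: by end_near. Qed.

(** To first order at 0, [sn e (w * S)] is [w * S]: small arcs compare like
    their chords. *)
Lemma small_sn e (S Y B : R) : 0 < B ->
  (S < Y -> exists2 w, 0 < w < B & sn e (w * S) < w * Y) /\
  (Y < S -> exists2 w, 0 < w < B & w * Y < sn e (w * S)).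
Proof.
move=> B0.
have h := is_derive_scaled (is_derive_sn e (S * 0)).
rewrite mulr0 cs0 mulr1 in h.
have fE (c : R) : is_derive (0 : R) (1 : R) (fun w => c * (sn e (S * w) - w * Y)) (c * (S - Y)).
  have i : is_derive (0 : R) (1 : R) (fun w : R => w * Y) Y.
    by apply: is_derive_eq; rewrite /GRing.scale /= mulr0 add0r mulr1.
  exact: (trigger_derive (is_deriveZ c (is_deriveB h i))).
have f0 (c : R) : c * (sn e (S * 0) - 0 * Y) = 0 by rewrite mulr0 sn0 mul0r subrr mulr0.
have rp (c : R) : 0 < c * (S - Y) -> exists2 w, 0 < w < B & 0 < c * (sn e (w * S) - w * Y).
  move=> c0; have hp := right_pos (fE c) (f0 c) c0.
  have [w hw] : exists w, [/\ 0 < w, w < B & 0 < c * (sn e (S * w) - w * Y)].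
    near (0 : R)^'+ => w; exists w; split; near: w.
    - exact: nbhs_right_gt.
    - exact: nbhs_right_lt.
    - exact: hp.
  by have [w0 wB hh] := hw; exists w; rewrite ?w0// [w * S]mulrC.
split=> SY.
  have [|w wB hw] := rp (-1); first by rewrite mulN1r opprB subr_gt0.
  by exists w => //; rewrite mulN1r opprB subr_gt0 in hw.
have [|w wB hw] := rp 1; first by rewrite mul1r subr_gt0.
by exists w => //; rewrite mul1r subr_gt0 in hw.
Unshelve. all: by end_near. Qed.

(** The inverse of [sn e] on [[0, b]], which is arcsine or its hyperbolic
    analogue. Its continuity up to the right end matters: on the smallest circle
    a longest side is a diameter. *)
Lemma asn_exists e b : 0 < b -> short e b -> 0 <= cs e b ->
  exists f : R -> R, [/\ {within `[0, sn e b], continuous f},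
    forall u, 0 <= u <= sn e b -> 0 <= f u <= b /\ sn e (f u) = u
    & forall t, 0 <= t <= b -> f (sn e t) = t].
Proof.
move=> b0 sb cb.
pose f u := get [set t | 0 <= t <= b /\ sn e t = u].
have inj s t : 0 <= s <= b -> 0 <= t <= b -> sn e s = sn e t -> s = t.
  have lt a c : 0 <= a -> a < c -> c <= b -> sn e a < sn e c.
    move=> a0 ac cb'; have c0 := le_lt_trans a0 ac.
    have sc : short e c by apply: short_le sb.
    by apply: sn_lt => //; apply: (cs_ge0_le (ltW c0) cb').
  move=> /andP[s0 s1] /andP[t0 t1] st; have [h|h|//] := ltgtP s t.
    by have := lt _ _ s0 h t1; rewrite st ltxx.
  by have := lt _ _ t0 h s1; rewrite st ltxx.
have fK t : 0 <= t <= b -> f (sn e t) = t.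
  move=> tb; rewrite /f; have [h1 h2] := @getI _ [set t' | 0 <= t' <= b /\ sn e t' = sn e t] t (conj tb erefl).
  exact: inj.
have ct : {within `[0, b], continuous (sn e)}.
  exact/continuous_subspaceT/sn_continuous.
have sb0 : 0 <= sn e b by rewrite ltW// sn_gt0.
exists f; split=> //.
- have := @segment_can_le_continuous R 0 b (sn e) f (ltW b0) ct; rewrite sn0; apply.
  by move=> t; rewrite in_itv /=; exact: fK.
- move=> u ub; have [|t] := @IVT R (sn e) 0 b u (ltW b0) ct.
    by rewrite sn0 min_l// max_r.
  by rewrite in_itv /= => tb <-; rewrite fK.
Qed.

Lemma within_scale (f : R -> R) (c W : R) : {within `[0, c], continuous f} ->
  forall y, 0 <= y -> W * y <= c ->
  {within `[0, W], continuous (fun w => f (w * y))}.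
Proof.
move=> /subspace_continuousP cf y y0 Wy; apply/subspace_continuousP => w wW.
have inA v : `[0, W] v -> `[0, c] (v * y).
  rewrite /= !in_itv /= => /andP[v0 vW]; rewrite mulr_ge0//=.
  by apply: le_trans Wy; rewrite ler_wpM2r.
move=> U /(cf _ (inA _ wW)) hU.
have : \forall v \near w, `[0, c] (v * y) -> U (f (v * y)).
  have cm : {for w, continuous (fun v : R => v * y)}.
    by move=> ?; apply: cvgM; [exact: cvg_id|exact: cvg_cst].
  exact: (cm _ hU).
rewrite /nbhs /= /fmap /= /within /=.
apply: filterS => v hv vW; exact/hv/inA.
Qed.

Lemma within_sum (A : set R) n (f : nat -> R -> R) :
  (forall i, (i < n)%N -> {within A, continuous (f i)}) ->
  {within A, continuous (fun w => \sum_(i < n) f i w)}.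
Proof.
elim: n => [|n IH] h.
  have -> : (fun w => \sum_(i < 0) f i w) = cst 0.
    by apply/funext => w; rewrite big_ord0.
  by apply: continuous_subspaceT => w; exact: cvg_cst.
have -> : (fun w => \sum_(i < n.+1) f i w) = (fun w => \sum_(i < n) f i w) + f n.
  by apply/funext => w; rewrite big_ord_recr.
by apply: within_continuousD; [apply: IH => i /ltnW; exact: h|exact: h].
Qed.

End ClosingParameter.

Section ClosingParameterExists.
Context {R : realType}.
Implicit Types (x t u e w b : R).
Local Open Scope classical_set_scope.

Section Arcsine.
Variables (e b : R) (f : R -> R).
Hypotheses (b0 : 0 < b) (sb : short e b) (cb : 0 <= cs e b).
Hypothesis cf : {within `[0, sn e b], continuous f}.
Hypothesis fP : forall u, 0 <= u <= sn e b -> 0 <= f u <= b /\ sn e (f u) = u.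
Hypothesis fK : forall t, 0 <= t <= b -> f (sn e t) = t.

Lemma asn0 : f 0 = 0.
Proof. by rewrite -[in LHS](sn0 e) fK// lexx ltW. Qed.

Lemma asn_gt0 u : 0 < u <= sn e b -> 0 < f u.
Proof.
move=> /andP[u0 ub]; have [|/andP[f0 _] fu] := @fP u; first by rewrite (ltW u0).
rewrite lt_neqAle f0 andbT; apply/eqP => f0'.
by move: u0; rewrite -fu -f0' sn0 ltxx.
Qed.

Lemma asn_lt u v : 0 <= u -> u < v -> v <= sn e b -> f u < f v.
Proof.
move=> u0 uv vb; have [|/andP[fu0 fub] fu] := @fP u.
  by rewrite u0 (le_trans (ltW uv)).
have [|/andP[fv0 fvb] fv] := @fP v; first by rewrite vb (le_trans u0 (ltW uv)).
rewrite ltNge; apply/negP; rewrite le_eqVlt => /orP[/eqP h|h].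
  by move: uv; rewrite -fu -fv h ltxx.
have f0 := le_lt_trans fv0 h; have sf : short e (f u) by exact: short_le sb.
have := sn_lt fv0 h sf (cs_ge0_le (ltW f0) fub sb cb).
by rewrite fu fv => /(lt_trans uv); rewrite ltxx.
Qed.

Variables (N : nat) (y : nat -> R) (Y W : R).
Hypotheses (N0 : (0 < N)%N) (y0 : forall i, (i < N)%N -> 0 < y i <= Y).
Hypotheses (Y0 : 0 < Y) (W0 : 0 < W) (WY : W * Y = sn e b).

Let arg_range w u : 0 <= w <= W -> 0 <= u <= Y -> 0 <= w * u <= sn e b.
Proof.
move=> /andP[w0 wW] /andP[u0 uY]; rewrite mulr_ge0//= -WY.
by rewrite ler_pM.
Qed.

(** The total half arc, scaled by [w], of the chords y_i on the curve with
    parameter [e * w ^+ 2]. *)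
Local Notation total w := (\sum_(i < N) f (w * y i)).

Lemma total_within : {within `[0, W], continuous (fun w => total w)}.
Proof.
apply: (@within_sum R _ N (fun i w => f (w * y i))) => i iN.
have /andP[yi yY] := y0 iN.
by apply: (within_scale cf); [exact: ltW|rewrite -WY ler_wpM2l// ltW].
Qed.

(** It suffices to find the scale [w] at which the total half arc has the chord
    [Y]; dividing by [w] gives the half arcs. *)
Lemma rescale_closing w : 0 < w <= W -> short e (total w) -> sn e (total w) = w * Y ->
  exists z : nat -> R,
    [/\ forall i, (i < N)%N -> 0 < z i /\ sn (e * w ^+ 2) (z i) = y i,
        short (e * w ^+ 2) (\sum_(i < N) z i)
      & sn (e * w ^+ 2) (\sum_(i < N) z i) = Y].
Proof.
move=> /andP[w0 wW] st et; exists (fun i => f (w * y i) / w).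
have wt : w * (\sum_(i < N) f (w * y i) / w) = total w.
  by rewrite -mulr_suml mulrC divfK// gt_eqF.
split.
- move=> i iN; have /andP[yi yY] := y0 iN.
  have ra : 0 <= w * y i <= sn e b by apply: arg_range; rewrite ?(ltW w0) ?(ltW yi).
  split.
    rewrite divr_gt0// asn_gt0//; move: ra => /andP[_ ->].
    by rewrite mulr_gt0.
  by rewrite sn_rescale// [w * (_ / w)]mulrC divfK ?gt_eqF// (fP ra).2 mulrC mulKf// gt_eqF.
- by apply: short_rescale => //; rewrite wt.
- by rewrite sn_rescale// wt et mulrC mulKf// gt_eqF.
Qed.

(** Intermediate value theorem for the defect between the total half arc and the
    half arc of the closing chord. *)
Lemma balance_root w0 : 0 < w0 <= W ->
  (total w0 <= f (w0 * Y) /\ f (W * Y) <= total W) \/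
  (f (w0 * Y) <= total w0 /\ total W <= f (W * Y)) ->
  exists2 w, w0 <= w <= W & total w = f (w * Y).
Proof.
move=> /andP[w00 w0W] h.
have cY : {within `[0, W], continuous (fun w => - f (w * Y))}.
  by move=> ?; apply: cvgN; apply: (within_scale cf (ltW Y0)); rewrite WY.
have cd : {within `[w0, W], continuous ((fun w => total w) + (fun w => - f (w * Y)))}.
  apply: (@continuous_subspaceW _ _ _ `[0, W]).
    by move=> v /=; rewrite !in_itv /= => /andP[v0 ->]; rewrite andbT (le_trans (ltW w00)).
  exact: within_continuousD total_within cY.
have [|w] := IVT (v := 0) w0W cd.
  rewrite !fctE; case: h => -[h1 h2].
    by rewrite ge_min le_max !subr_le0 !subr_ge0 h1 h2 orbT.
  by rewrite ge_min le_max !subr_le0 !subr_ge0 h1 h2 orbT.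
by rewrite in_itv /= => wW /eqP; rewrite fctE subr_eq0 => /eqP; exists w.
Qed.

Lemma balance_closing w : 0 < w <= W -> total w = f (w * Y) ->
  short e (total w) /\ sn e (total w) = w * Y.
Proof.
move=> /andP[w0 wW] ->.
have ra : 0 <= w * Y <= sn e b by apply: arg_range; rewrite ?(ltW w0) ?(ltW Y0) ?lexx.
have [/andP[_ fb] ->] := fP ra; split=> //.
apply: short_le fb sb; apply: asn_gt0; move: ra => /andP[_ ->].
by rewrite mulr_gt0.
Qed.

End Arcsine.

(** The chords [sn 1 (a i)] are the sides of a Euclidean polygon with longest
    side [sn 1 L] precisely if their sum exceeds it; equality corresponds to the
    horocycle. If the sum is smaller, the chain is too short at scale 0, but too
    long on the geodesic (scale 1, where half arcs are the [a i] and [L]), so it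
    closes on a hypercycle in between. If the sum is larger, the chain is too long
    at scale 0; on the smallest circle, of which the longest side is a diameter,
    either it is too short and closes up on one side of the center on a larger
    circle, or it covers a half turn, and then on some circle at least as large
    chain and longest side together make one full turn, the center lying
    inside. *)
Theorem closing_parameter N (a : nat -> R) (L : R) : (0 < N)%N ->
  (forall i, (i < N)%N -> 0 < a i <= L) -> L < \sum_(i < N) a i ->
  exists x (z : nat -> R),
    [/\ x < 1, forall i, (i < N)%N -> 0 < z i /\ sn x (z i) = sn 1 (a i),
        short x (\sum_(i < N) z i) & sn x (\sum_(i < N) z i) = sn 1 L].
Proof.
move=> N0 aL La.
have L0 : 0 < L by have /andP[a0] := aL 0%N N0; exact: lt_le_trans.
have Y0 : 0 < sn 1 L by apply/sn_gt0/short_ge0.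
pose y i : R := sn 1 (a i); pose Y : R := sn 1 L.
have y0 i : (i < N)%N -> 0 < y i <= Y.
  move=> /aL /andP[a0 aL']; rewrite /y /Y sn_gt0/=; last exact: short_ge0.
  by rewrite leNgt sn_ge0_mono ?ltW// -leNgt.
pose S := \sum_(i < N) y i.
have S0 : 0 < S by apply: sum_gt0 => // i /y0 /andP[].
rewrite -/Y.
have [SY|YS|SY] := ltgtP S Y.
- have sb : short 1 L by exact: short_ge0.
  have cb : 0 <= cs 1 L by rewrite ltW// cs_gt0.
  have [f [cf fP fK]] := asn_exists L0 sb cb.
  have WY : 1 * Y = sn 1 L by rewrite mul1r.
  (* The bound keeps w0 * S within [0, L], the domain on which f inverts sn. *)
  have B0 : 0 < Num.min 1 (L / S) by rewrite lt_min ltr01 divr_gt0.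
  have [w0 /andP[w00]] := (small_sn 1 S Y B0).1 SY.
  rewrite lt_min ltr_pdivlMr// => /andP[w01 w0S] hw0.
  have [||w /andP[w0w w1] hw] := balance_root cf y0 Y0 ltr01 WY (w0 := w0).
  + by rewrite w00 ltW.
  + left; split; last first.
      rewrite !mul1r fK ?lexx ?ltW//.
      rewrite (eq_bigr (fun i : 'I_N => a i)) ?ltW// => i _.
      have /andP[a0 ai] := aL i (ltn_ord i).
      by rewrite mul1r fK// ltW.
    have wS0 : 0 <= w0 * S by rewrite mulr_ge0// ltW.
    have hr u : 0 <= u <= Y -> 0 <= w0 * u <= sn 1 L.
      move=> /andP[u0 uY]; rewrite mulr_ge0 ?(ltW w00)//= -/Y.
      by apply: le_trans uY; rewrite ler_piMl// ltW.
    apply: (@le_trans _ _ (w0 * S)).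
      rewrite mulr_sumr; apply: ler_sum => i _; have /andP[yi yY] := y0 i (ltn_ord i).
      have [|/andP[f0 _] fe] := fP (w0 * y i); first by rewrite hr// ltW.
      by rewrite -[leRHS]fe sn1_ge.
    rewrite -[leLHS]fK; last by rewrite wS0 ltW.
    rewrite ltW//; apply: (asn_lt sb cb fP) => //.
      by rewrite (le_trans wS0)// sn1_ge.
    have YY : 0 <= Y <= Y by rewrite lexx ltW.
    by have /andP[] := hr Y YY.
  have w0' := lt_le_trans w00 w0w.
  have ww : 0 < w <= 1 by rewrite w0' w1.
  have [sT eT] := balance_closing (y := y) sb fP Y0 WY ww hw.
  have [z [hz1 hz2 hz3]] := rescale_closing fP y0 WY ww sT eT.
  exists (1 * w ^+ 2), z; split=> //.
  rewrite mul1r; move: w1; rewrite le_eqVlt => /orP[/eqP w1|w1].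
    (* At scale 1 the balance would say that L is the sum of the a i. *)
    exfalso; move: hw; rewrite w1 mul1r fK ?(ltW L0) ?lexx//.
    rewrite (eq_bigr (fun i : 'I_N => a i)); last first.
      move=> i _; have /andP[a0 ai] := aL i (ltn_ord i).
      by rewrite mul1r fK// ltW.
    by move=> h; move: La; rewrite h ltxx.
  by rewrite -(expr1n _ 2) ltr_pXn2r// nnegrE ltW.
- have pi20 : 0 < (pi / 2 : R) by rewrite divr_gt0// pi_gt0.
  have sb : short (- 1) (pi / 2 : R).
    split=> // _; rewrite normrN1 sqrtr1 mul1r ltr_pdivrMr// ltr_pMr ?pi_gt0//.
    by rewrite ltr1n.
  have sn1 : sn (- 1) (pi / 2 : R) = 1.
    by rewrite sn_neg ?ltrN10// normrN1 sqrtr1 mul1r divr1 sin_pihalf.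
  have cb : 0 <= cs (- 1) (pi / 2 : R).
    by rewrite cs_neg ?ltrN10// normrN1 sqrtr1 mul1r cos_pihalf.
  have [f [cf fP fK]] := asn_exists pi20 sb cb.
  set W := Y^-1; have W0 : 0 < W by rewrite invr_gt0.
  have WY : W * Y = sn (- 1) (pi / 2) by rewrite sn1 mulVf// gt_eqF.
  have fW : f (W * Y) = pi / 2 by rewrite WY fK// lexx ltW.
  have xlt w : 0 < w -> - 1 * w ^+ 2 < 1.
    by move=> w0; rewrite mulN1r (lt_trans _ ltr01)// oppr_lt0 exprn_gt0.
  have hr w u : 0 <= w <= W -> 0 <= u <= Y -> 0 <= w * u <= sn (-1) (pi / 2 : R).
    move=> /andP[w0 wW] /andP[u0 uY]; rewrite mulr_ge0//= -WY.
    by rewrite ler_pM.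
  (* W is the scale at which the longest side is a diameter. *)
  have [gW|gW] := leP (pi / 2) (\sum_(i < N) f (W * y i)).
    have cK : {within `[0, W], continuous
        ((fun w => \sum_(i < N) f (w * y i)) + (fun w => f (w * Y)))}.
      apply: within_continuousD; first exact: (total_within cf y0 W0 WY).
      by apply: (within_scale cf (ltW Y0)); rewrite WY.
    have K0 : \sum_(i < N) f (0 * y i) + f (0 * Y) = 0.
      rewrite mul0r (asn0 pi20 fK) big1 ?addr0// => i _.
      by rewrite mul0r (asn0 pi20 fK).
    have [|w] := IVT (v := pi) (ltW W0) cK.
      rewrite !fctE K0 fW ge_min pi_ge0 le_max /=.
      by apply/orP; right; lra.
    rewrite in_itv /= fctE => /andP[w0 wW] eK.
    have {}w0 : 0 < w.
      rewrite lt_neqAle w0 andbT; apply/eqP => w00.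
      by move: eK; rewrite -w00 K0 => /eqP; rewrite lt_eqF// pi_gt0.
    have ww : 0 < w <= W by rewrite w0.
    have rY : 0 <= w * Y <= sn (-1) (pi / 2 : R) by rewrite hr ?(ltW w0) ?(ltW Y0)/=.
    have [/andP[_ fb] fe] := fP _ rY.
    have fY0 : 0 < f (w * Y).
      by apply: (asn_gt0 fP); have /andP[_ ->] := rY; rewrite andbT mulr_gt0.
    (* The total is the supplement of the half arc of Y, with the same chord. *)
    have eT : \sum_(i < N) f (w * y i) = pi - f (w * Y) by rewrite -eK addrK.
    have [||z [hz1 hz2 hz3]] := rescale_closing fP y0 WY ww.
    + rewrite eT; split; first by have := pi_gt0 R; lra.
      by move=> _; rewrite normrN1 sqrtr1 mul1r gtrBl.
    + rewrite eT snB.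
      have -> : sn (- 1) pi = 0 :> R.
        by rewrite sn_neg ?ltrN10// normrN1 sqrtr1 mul1r divr1 sinpi.
      have -> : cs (- 1) pi = - 1 :> R.
        by rewrite cs_neg ?ltrN10// normrN1 sqrtr1 mul1r cospi.
      by rewrite fe; ring.
    by exists (- 1 * w ^+ 2), z; split=> //; exact: xlt.
  have B0 : 0 < Num.min W (pi / 2 / S) by rewrite lt_min W0 divr_gt0.
  have [w0 /andP[w00]] := (small_sn (- 1) S Y B0).2 YS.
  rewrite lt_min ltr_pdivlMr// => /andP[w01 w0S] hw0.
  have wS0 : 0 <= w0 * S by rewrite mulr_ge0// ltW.
  have hw0W : 0 <= w0 <= W by rewrite (ltW w00) ltW.
  have [||w /andP[w0w w1] hw] := balance_root cf y0 Y0 W0 WY (w0 := w0).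
  + by rewrite w00 ltW.
  + right; split; last by rewrite fW ltW.
    apply: (@le_trans _ _ (w0 * S)); last first.
      rewrite mulr_sumr; apply: ler_sum => i _; have /andP[yi yY] := y0 i (ltn_ord i).
      have [|/andP[f0 _] fe] := fP (w0 * y i); first by apply: hr => //; rewrite ltW.
      by rewrite -[leLHS]fe snN1_le.
    rewrite -[leRHS]fK; last by rewrite wS0 ltW.
    rewrite ltW//; apply: (asn_lt sb cb fP) => //.
      by rewrite mulr_ge0 ?ltW.
    have [->|ne] := eqVneq (w0 * S) (pi / 2); first by [].
    by rewrite ltW// sn_lt// w0S.
  have w0' := lt_le_trans w00 w0w.
  have ww : 0 < w <= W by rewrite w0' w1.
  have [sT eT] := balance_closing (y := y) sb fP Y0 WY ww hw.
  have [z [hz1 hz2 hz3]] := rescale_closing fP y0 WY ww sT eT.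
  by exists (- 1 * w ^+ 2), z; split=> //; exact: xlt.
- have s0E t : sn 0 t = t :> R by rewrite /sn ltxx eqxx.
  exists 0, y; split=> //; rewrite ?s0E//.
  + by move=> i iN; rewrite s0E; split=> //; have /andP[] := y0 i iN.
  + exact: short_ge0.
Qed.

End ClosingParameterExists.

(** * The model polygon *)

Section ModelCurve.
Context {R : realType}.
Variable k : R.
Let x := 1 - k ^+ 2.
Implicit Types (t a b d : R).

Definition model_point t : 'rV[R]_3 :=
  curve_at x k (delta_mx 0 0) (delta_mx 0 1) (delta_mx 0 2%:R) t.

Lemma model_pointE t : [/\ model_point t 0 0 = 1 + gn x t,
  model_point t 0 1 = sn x t & model_point t 0 2%:R = k * gn x t].
Proof. by rewrite /model_point /curve_at !mxE /=; split; ring. Qed.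

Lemma standard_frame :
  frame (delta_mx 0 0 : 'rV[R]_3) (delta_mx 0 1) (delta_mx 0 2%:R).
Proof. by rewrite /frame /mink !mxE /=; do ?split; ring. Qed.

Lemma mink_model a b : mink (model_point a) (model_point b) = - (1 + gn x (a - b)).
Proof. exact: mink_curve_at standard_frame. Qed.

Lemma model_point_H2 t :
  (mink (model_point t) (model_point t) == -1) && (0 < model_point t 0 0).
Proof.
rewrite mink_model subrr gn0 addr0 eqxx /=; have [-> _ _] := model_pointE t.
by rewrite ltr_pwDl// /gn mulr_ge0// sqr_ge0.
Qed.

Definition model_curve t : H2 R := MkH2 (model_point_H2 t).

Lemma derive1_coord (g h : R -> 'rV[R]_3) :
  (forall t i, is_derive t (1 : R) (fun s => g s 0 i) (h t 0 i)) ->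
  (forall t, derivable g t 1) /\ derive1 g = h.
Proof.
move=> gh; have dg t : derivable g t 1.
  by apply/derivable_mxP => i j; rewrite ord1; exact: ex_derive.
split=> //; apply/funext => t; rewrite derive1E derive_mx//.
by apply/rowP => i; rewrite mxE; exact: derive_val.
Qed.

Definition row3 (a b d : R) : 'rV[R]_3 :=
  a *: delta_mx 0 0 + b *: delta_mx 0 1 + d *: delta_mx 0 2%:R.

Lemma row3E a b d : [/\ row3 a b d 0 0 = a, row3 a b d 0 1 = b & row3 a b d 0 2%:R = d].
Proof. by rewrite /row3 !mxE /=; split; ring. Qed.

Lemma is_derive_row3 (g h : R -> 'rV[R]_3) (f0 f1 f2 d0 d1 d2 : R -> R) :
  (forall t, g t = row3 (f0 t) (f1 t) (f2 t)) ->
  (forall t, h t = row3 (d0 t) (d1 t) (d2 t)) ->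
  (forall t, is_derive t (1 : R) f0 (d0 t)) ->
  (forall t, is_derive t (1 : R) f1 (d1 t)) ->
  (forall t, is_derive t (1 : R) f2 (d2 t)) ->
  forall t i, is_derive t (1 : R) (fun s => g s 0 i) (h t 0 i).
Proof.
move=> gE hE D0 D1 D2 t i; rewrite hE.
have -> : (fun s => g s 0 i) = (fun s => row3 (f0 s) (f1 s) (f2 s) 0 i).
  by apply/funext => s; rewrite gE.
case: (ord3P i) => ->.
- have [-> _ _] := row3E (d0 t) (d1 t) (d2 t).
  suff -> : (fun s => row3 (f0 s) (f1 s) (f2 s) 0 0) = f0 by [].
  by apply/funext => s; have [] := row3E (f0 s) (f1 s) (f2 s).
- have [_ -> _] := row3E (d0 t) (d1 t) (d2 t).
  suff -> : (fun s => row3 (f0 s) (f1 s) (f2 s) 0 1) = f1 by [].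
  by apply/funext => s; have [] := row3E (f0 s) (f1 s) (f2 s).
- have [_ _ ->] := row3E (d0 t) (d1 t) (d2 t).
  suff -> : (fun s => row3 (f0 s) (f1 s) (f2 s) 0 2%:R) = f2 by [].
  by apply/funext => s; have [] := row3E (f0 s) (f1 s) (f2 s).
Qed.

Lemma model_curve_curvature : constant_curvature_curve model_curve k.
Proof.
rewrite /constant_curvature_curve.
pose v t := row3 (sn x t) (cs x t) (k * sn x t).
pose w t := row3 (cs x t) (x * sn x t) (k * cs x t).
have D1 := @is_derive_row3 model_point v (fun t => 1 + gn x t) (sn x)
  (fun t => k * gn x t) (sn x) (cs x) (fun t => k * sn x t) (fun _ => erefl)
  (fun _ => erefl).
have D2 := @is_derive_row3 v w (sn x) (cs x) (fun t => k * sn x t)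
  (cs x) (fun t => x * sn x t) (fun t => k * cs x t) (fun _ => erefl)
  (fun _ => erefl).
have [||dg ->] := derive1_coord (D1 _ (is_derive_sn x) _).
- move=> t; apply: (trigger_derive (is_deriveD (is_derive_cst (1 : R) t (1 : R)) (is_derive_gn x t))).
  by rewrite add0r.
- by move=> t; exact: (is_deriveZ k (is_derive_gn x t)).
have [|dv ->] := derive1_coord (D2 (is_derive_sn x) (is_derive_cs x) _).
  by move=> t; exact: (is_deriveZ k (is_derive_sn x t)).
have vE t := row3E (sn x t) (cs x t) (k * sn x t).
split; [exact: dg|exact: dv|move=> t|move=> t]; have := vE t.
- rewrite /v; move: (row3 _ _ _) => u [v0 v1 v2]; rewrite /mink v0 v1 v2.
  have -> : - (sn x t * sn x t) + cs x t * cs x t + k * sn x t * (k * sn x t) =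
    cs x t ^+ 2 - x * sn x t ^+ 2 by rewrite /x; ring.
  by rewrite cs2 addrK.
- have := row3E (cs x t) (x * sn x t) (k * cs x t); have := model_pointE t.
  rewrite /v /w /=; move: (model_point t) (row3 (sn x t) _ _) (row3 (cs x t) _ _).
  move=> m v1 v2 [m0 m1 m2] [w0 w1 w2] [r0 r1 r2].
  rewrite det3E m0 m1 m2 w0 w1 w2 r0 r1 r2.
  by apply: (lincomb2 (c1 := k) (c2 := 0) (cs2 x t) (cs2 x t)); ring.
Qed.

(** The orientation of three points of the curve: as in the Euclidean formula
    for the area of a triangle in a circle, the determinant is a multiple of the
    product of the three half chords, which makes inscribed polygons convex. *)
Lemma det3_model a b d :
  det3 (model_point a) (model_point b) (model_point d) =
  4 * k * (sn x ((b - a) / 2) * sn x ((d - b) / 2) * sn x ((d - a) / 2)).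
Proof.
have := model_pointE a; have := model_pointE b; have := model_pointE d.
move: (model_point a) (model_point b) (model_point d) => u v w.
move=> [d0 d1 d2] [b0 b1 b2] [a0 a1 a2].
rewrite det3E a0 a1 a2 b0 b1 b2 d0 d1 d2 [sn x a]sn_half [sn x b]sn_half [sn x d]sn_half.
rewrite ![(_ - _) / 2]mulrBl !snB /gn.
have := cs2 x (a / 2); have := cs2 x (b / 2); have := cs2 x (d / 2).
move: (sn x (a / 2)) (sn x (b / 2)) (sn x (d / 2)) => A B D.
move: (cs x (a / 2)) (cs x (b / 2)) (cs x (d / 2)) => a' b' d' hd hb ha.
(* The difference of both sides is a combination of the three relations
   between sine and cosine; two of them are used in the second equation. *)
apply: (lincomb2 (c1 := - (4 * k * (B * D ^+ 2 * b' - B ^+ 2 * D * d')))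
  (c2 := 1) (r2 := 4 * k * ((A * B ^+ 2 * a' - A ^+ 2 * B * b') * (d' ^+ 2 - 1)
     + (A ^+ 2 * D * d' - A * D ^+ 2 * a') * (b' ^+ 2 - 1)
     - (A * B ^+ 2 * a' - A ^+ 2 * B * b') * (x * D ^+ 2)
     - (A ^+ 2 * D * d' - A * D ^+ 2 * a') * (x * B ^+ 2))) (l2 := 0) ha).
  by rewrite hd hb; ring.
by ring.
Qed.

End ModelCurve.

Section ModelPolygon.
Context {R : realType}.
Variables (N : nat) (m : 'I_N.+1) (l : 'I_N.+1 -> R) (k : R) (z : nat -> R).
Let x := 1 - k ^+ 2.
Let T i := \sum_(j < i) z j.
Hypotheses (N1 : (1 < N)%N) (k0 : 0 < k) (l0 : forall i, 0 < l i).
Hypothesis z0 : forall i, (i < N)%N -> 0 < z i.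
Hypothesis zl : forall i, (i < N)%N -> sn x (z i) = sn 1 (cyc l (m.+1 + i) / 2).
Hypothesis shortT : short x (T N).
Hypothesis closeT : sn x (T N) = sn 1 (l m / 2).

Let T_lt i j : (i < j <= N)%N -> T i < T j.
Proof.
move=> /andP[ij jN]; apply: (@lt_le_trans _ _ (T i.+1)).
  by rewrite /T big_ord_recr /= ltrDl z0// (leq_trans ij).
by apply: sum_le => // n nj; apply: z0; exact: leq_trans jN.
Qed.

Let T_short i j : (i < j <= N)%N -> short x (T j - T i).
Proof.
move=> /andP[ij jN]; apply: short_le shortT.
  by rewrite subr_gt0 T_lt// ij.
have T0 : 0 <= T i.
  by rewrite sumr_ge0// => n _; rewrite ltW// z0// (leq_trans (ltn_ord n))// ltnW// (leq_trans ij).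
have TN : T j <= T N by apply: sum_le.
by lra.
Qed.

(** The place of vertex [i] along the curve when the vertices are listed from the
    successor of [m]: [N * m.+1] is [- m.+1] modulo [N.+1]. *)
Definition position (i : 'I_N.+1) : nat := (i + N * m.+1) %% N.+1.

Lemma position_le i : (position i <= N)%N.
Proof. by rewrite -ltnS ltn_pmod. Qed.

Lemma positionK i : m.+1 + position i = i %[mod N.+1].
Proof. by rewrite modnDmr addnCA -mulSn addnC mulnC modnMDl. Qed.

Lemma position_inj : injective position.
Proof.
move=> i j ij; apply: val_inj; rewrite /= -(modn_small (ltn_ord i)).
by rewrite -(modn_small (ltn_ord j)) -positionK -[RHS]positionK ij.
Qed.

Lemma position_ordS i :
  position (ordS i) = if (position i < N)%N then (position i).+1 else 0%N.
Proof.
have e : position (ordS i) = (position i).+1 %[mod N.+1].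
  rewrite /position ordSE inordK ?ltn_pmod// -[((_ %% _)%N).+1]addn1 !modnDml.
  by rewrite modn_mod addnAC addn1.
case: ifP => iN.
  by move: e; rewrite !modn_small// ltnS position_le.
have iE : position i = N by apply/eqP; rewrite eqn_leq position_le leqNgt iN.
by move: e; rewrite iE modnn modn_small// ltnS position_le.
Qed.

Definition model_polygon (i : 'I_N.+1) : H2 R := model_curve k (2 * T (position i)).

Lemma mink_model_polygon i j : mink (model_polygon i) (model_polygon j) =
  - (1 + 2 * sn x (T (position i) - T (position j)) ^+ 2).
Proof.
rewrite /model_polygon /= mink_model /gn.
by congr (- (1 + 2 * sn _ _ ^+ 2)); field.
Qed.

Lemma model_polygon_inj : injective model_polygon.
Proof.
move=> i j ij; apply: position_inj.
have := mink_model_polygon i j; rewrite ij; have [-> _] := H2E (model_polygon j).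
move=> h; have {}h : sn x (T (position i) - T (position j)) ^+ 2 = 0 by lra.
move/eqP: h; rewrite sqrf_eq0 => /eqP h.
have [ltp|gtp|//] := ltngtP (position i) (position j).
  have := @T_short (position i) (position j); rewrite ltp position_le => /(_ isT).
  by move/sn_gt0; rewrite -opprB snN h oppr0 ltxx.
have := @T_short (position j) (position i); rewrite gtp position_le => /(_ isT).
by move/sn_gt0; rewrite h ltxx.
Qed.

Lemma det3_model_polygon i j n :
  det3 (model_polygon i) (model_polygon j) (model_polygon n) = 4 * k *
    (sn x (T (position j) - T (position i)) * sn x (T (position n) - T (position j)) *
     sn x (T (position n) - T (position i))).
Proof.
rewrite /model_polygon /= det3_model -/x.
by congr (_ * (sn _ _ * sn _ _ * sn _ _)); field.
Qed.

Let sn_pos i j : (i < j <= N)%N -> 0 < sn x (T j - T i).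
Proof. by move/T_short/sn_gt0. Qed.

Let sn_neg' i j : (i < j <= N)%N -> sn x (T i - T j) < 0.
Proof. by move/sn_pos => h; rewrite -opprB snN oppr_lt0. Qed.

(** The three sine factors of [det3_model_polygon] have a positive product for
    each edge: all are positive, or two are negative. For the closing edge,
    from position N back to position 0, the negative factors are the first and
    the last. *)
Lemma model_polygon_convex : convex_polygon model_polygon.
Proof.
split; first exact: model_polygon_inj.
move=> i; left => j ji jsi; rewrite det3_model_polygon.
have {ji}ji : position j != position i by rewrite (inj_eq position_inj).
have {jsi}jsi : position j != position (ordS i) by rewrite (inj_eq position_inj).
rewrite position_ordS in jsi *.
have jN := position_le j; move: (position j) (position i) (position_le i) jN ji jsi.
move=> b a aN bN ba; rewrite pmulr_rgt0; last exact: mulr_gt0.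
case: ifP => [ltaN|geaN] bs.
  have a1 : 0 < sn x (T a.+1 - T a) by apply: sn_pos; rewrite ltnSn.
  have [ab|ab] := ltnP a b.
    rewrite !mulr_gt0//; apply: sn_pos; rewrite ?ab// bN andbT.
    by rewrite ltn_neqAle eq_sym bs.
  have lba : (b < a)%N by rewrite ltn_neqAle ba.
  rewrite -mulrA pmulr_rgt0// nmulr_rgt0; apply: sn_neg'.
    by rewrite lba.
  by rewrite ltnS ltnW.
have aE : a = N by apply/eqP; rewrite eqn_leq aN leqNgt geaN.
have b0 : (0 < b)%N by rewrite lt0n.
have lbN : (b < N)%N by rewrite ltn_neqAle -[X in _ != X]aE ba.
rewrite aE -mulrA nmulr_rgt0; last by apply: sn_neg'; rewrite leqnn ltnW.
rewrite pmulr_rlt0; first by apply: sn_neg'; rewrite lbN leqnn.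
by apply: sn_pos; rewrite b0.
Qed.

(** The curve is injective on the arc because two of its points coincide only if
    [sn] vanishes at half their parameter difference. *)
Lemma model_polygon_in_order : occur_in_order model_polygon (model_curve k).
Proof.
have TN0 : 0 < T N by case: shortT.
exists 0, (2 * T N), (fun i => 2 * T i), m.+1; split.
- move=> a b; rewrite !in_itv /= => /andP[a0 aN] /andP[b0 bN] ab.
  have := mink_model k a b; have [/= eb _] := H2E (model_curve k b).
  have -> : model_point k a = model_point k b by have := congr1 (@H2val R) ab.
  rewrite eb -/x => h; have {}h : sn x ((a - b) / 2) ^+ 2 = 0.
    by move: h; rewrite /gn; lra.
  move/eqP: h; rewrite sqrf_eq0 => /eqP h.
  have [ltab|ltba|//] := ltgtP a b.
    have : short x ((b - a) / 2) by apply: short_le shortT; lra.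
    by move/sn_gt0; rewrite -opprB mulNr snN h oppr0 ltxx.
  have : short x ((a - b) / 2) by apply: short_le shortT; lra.
  by move/sn_gt0; rewrite h ltxx.
- move=> i; rewrite in_itv /= ler_pM2l// mulr_ge0//=.
    by apply: sum_le => //; rewrite -ltnS.
  by rewrite sumr_ge0// => n _; rewrite ltW// z0// (leq_trans (ltn_ord n))// -ltnS.
- by move=> i j ij; rewrite ltr_pM2l// T_lt// ij -ltnS /=.
- move=> i; rewrite cyc_iter /cyc /model_polygon; congr (model_curve k (2 * T _)).
  have e : m.+1 + position (inord ((m.+1 + i) %% N.+1)) = m.+1 + i %[mod N.+1].
    by rewrite positionK inordK ?ltn_pmod// modn_mod.
  move/eqP: e; rewrite eqn_modDl (modn_small (ltn_ord i)) modn_small.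
    by move/eqP.
  by rewrite ltnS position_le.
Qed.

Lemma model_polygon_sides : has_side_lengths model_polygon l.
Proof.
move=> i; rewrite /has_side_lengths.
have e := mink_model_polygon i (ordS i); rewrite position_ordS in e.
move: e; case: ifP => iN e.
  have s0 : 0 < sn x (z (position i)).
    by rewrite zl// sn_gt0//; apply: short_ge0 => //; rewrite divr_gt0// l0.
  have {}e : mink (model_polygon i) (model_polygon (ordS i)) =
      - (1 + 2 * sn x (z (position i)) ^+ 2).
    rewrite e -sqrrN -snN opprB; congr (- (1 + 2 * sn _ _ ^+ 2)).
    by rewrite /T big_ord_recr /=; ring.
  apply/(hdist_half _ (ltW s0) e); split; first exact: ltW.
  by rewrite zl// (cycE l (positionK i)) cyc_ord.
have iE : position i = N by apply/eqP; rewrite eqn_leq position_le leqNgt iN.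
have im : i = m.
  apply: val_inj; have := positionK i; rewrite iE addSnnS modnDr !modn_small//.
have s0 := sn_gt0 shortT.
have {}e : mink (model_polygon i) (model_polygon (ordS i)) = - (1 + 2 * sn x (T N) ^+ 2).
  by rewrite e iE {2}/T big_ord0 subr0.
apply/(hdist_half _ (ltW s0) e); split; first exact: ltW.
by rewrite closeT im.
Qed.

Lemma model_polygon_cyclic : cyclic_polygon model_polygon.
Proof.
split; first exact: model_polygon_convex.
exists (model_curve k), k; split; first by rewrite gt_eqF.
  exact: model_curve_curvature.
exact: model_polygon_in_order.
Qed.

End ModelPolygon.

(** * Existence and uniqueness of cyclic polygons *)

Lemma exists_cyclic_polygon (R : realType) N (l : 'I_N.+1 -> R) (m : 'I_N.+1) :
  (1 < N)%N -> (forall i, 0 < l i) -> (forall i, l i <= l m) ->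
  l m < \sum_(i < N.+1 | i != m) l i ->
  exists p, cyclic_polygon p /\ has_side_lengths p l.
Proof.
move=> N1 l0 lm lt_sum.
have [i iN||x [z [x1 hz sT cT]]] := @closing_parameter R N
  (fun i => cyc l (m.+1 + i) / 2) (l m / 2) (ltnW N1).
- by rewrite divr_gt0 ?l0//= ler_pM2r ?invr_gt0// lm.
- by rewrite -mulr_suml ltr_pM2r ?invr_gt0// sum_cyc.
pose k := Num.sqrt (1 - x).
have k0 : 0 < k by rewrite sqrtr_gt0 subr_gt0.
have xk : x = 1 - k ^+ 2 by rewrite sqr_sqrtr ?subr_ge0 ?(ltW x1)//; ring.
rewrite xk in hz sT cT.
exists (model_polygon m k z); split.
  by apply: (@model_polygon_cyclic _ N m k z) => // i /hz[].
by apply: model_polygon_sides => // i /hz[].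
Qed.

Lemma convex_polygon_det3 (R : realType) N (p : 'I_N.+1 -> H2 R) : (1 < N)%N ->
  convex_polygon p -> det3 (p (inord 0)) (p (inord 1)) (p (inord 2)) != 0.
Proof.
move=> N1 [_ conv]; have := conv (inord 0).
have -> : ordS (inord 0 : 'I_N.+1) = inord 1.
  by rewrite ordSE inordK// modn_small// ltnW.
have n2 c : (c < 2)%N -> (inord 2 : 'I_N.+1) != inord c.
  move=> c2; apply/eqP => /(congr1 val) /=; rewrite !inordK//; last first.
    exact: ltn_trans c2 _.
  by move=> e; rewrite -e in c2.
by case=> /(_ (inord 2) (n2 0%N isT) (n2 1%N isT)) h; [rewrite gt_eqF|rewrite lt_eqF].
Qed.

Theorem theorem3 (R : realType) (n : nat) (hn : (3 <= n)%N) (l : 'I_n -> R)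
    (hl : forall k, 0 < l k) :
  ((exists p : 'I_n -> H2 R, cyclic_polygon p /\ has_side_lengths p l) <->
   (forall k : 'I_n, l k < \sum_(i < n | i != k) l i)) /\
  ((forall k : 'I_n, l k < \sum_(i < n | i != k) l i) ->
   forall p q : 'I_n -> H2 R,
     cyclic_polygon p -> has_side_lengths p l ->
     cyclic_polygon q -> has_side_lengths q l ->
     congruent p q).
Proof.
case: n hn l hl => // N N1 l l0.
have [m lm] : exists m, forall i, l i <= l m.
  have [m _ hm] := @arg_maxP _ R _ ord0 xpredT l isT.
  by exists m => i; exact: hm.
split; [split=> [[p [cp pl]] k|h]|].
- have [->|km] := eqVneq k m; first exact: longest_lt_sum lm l0 cp pl.
  have [j jk jm] : exists2 j, j != k & j != m.
    have : (0 < #|~: [set k; m]|)%N.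
      by rewrite cardsCs finset.setCK card_ord cards2 subn_gt0; case: (_ != _) => /=; [|apply: ltnW].
    by case/card_gt0P => j; rewrite !inE negb_or => /andP[]; exists j.
  apply: (le_lt_trans (lm k)); rewrite (bigD1 m) 1?eq_sym//= ltrDl.
  rewrite (bigD1 j) ?jk//= ltr_pwDl// sumr_ge0// => i _; exact/ltW/l0.
- exact: exists_cyclic_polygon lm (h m).
- move=> _ p q cp pl cq ql.
  have gram := cyclic_polygon_gram N1 lm l0 cp pl cq ql.
  exact: congruent_of_gram (convex_polygon_det3 N1 cp.1) (convex_polygon_det3 N1 cq.1) gram.
Qed.
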